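(* Let $a=a(n)$ be a positive integer (a function of $n$), and consider the $(a:b)$ Maker-Breaker Hamiltonicity game on $K_n$ with Breaker moving first. (i) Let $a=o\left(\sqrt{\frac{n}{\ln n}}\right)$. For every $\varepsilon>0$ there is an $n_0\in\mathbb N$ (depending on $\varepsilon$ and on the function $a$) such that for every $n\ge n_0$, Breaker wins the $(a:b)$ Hamiltonicity game if $b\ge(1+\varepsilon)\frac{an}{a+\ln n}$, and Maker wins if $b\le(1-\varepsilon)\frac{an}{a+\ln n}$. (ii) Let $a=\Omega\left(\sqrt{\frac{n}{\ln n}}\right)$. For every $\varepsilon>0$ there is an $n_0\in\mathbb N$ (depending on $\varepsilon$ and on the function $a$) such that for every $n\ge n_0$, Breaker wins the $(a:b)$ Hamiltonicity game if $b\ge(1+\varepsilon)n$, and Maker wins if $b\le(1-\varepsilon)n$. Here $b$ ranges over positive integers, and ''wins'' means ''has a winning strategy''.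
   Context: The $(a:b)$ Maker-Breaker Hamiltonicity game on $K_n$: the board is the edge set of the complete graph $K_n$ on $n$ vertices. In each round Breaker first claims $b$ previously unclaimed edges, then Maker claims $a$ previously unclaimed edges (if fewer edges remain, a player claims all remaining ones). Maker wins if at the end of the game his edges contain a Hamilton cycle of $K_n$; otherwise Breaker wins. *)

(* Defs.v *)
From mathcomp Require Import all_boot.

Set Implicit Arguments.
Unset Strict Implicit.
Unset Printing Implicit Defensive.

Inductive player := Maker | Breaker.

Section Game.
Variable n : nat.

(* The edges of K_n are the 2-subsets of the vertex set 'I_n; a move is the
   whole set of edges that a player claims in one turn. *)
Definition board : {set {set 'I_n}} := [set e : {set 'I_n} | #|e| == 2].

Definition move := {set {set 'I_n}}.

(* A history lists the moves made so far, oldest first.  The players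
   alternate and Breaker starts, so Breaker owns the even positions. *)
Definition history := seq move.

Definition turn (i : nat) : player := if odd i then Maker else Breaker.

Definition free_edges (h : history) : {set {set 'I_n}} :=
  board :\: \bigcup_(X <- h) X.

Definition bias (a b : nat) (p : player) : nat :=
  match p with Maker => a | Breaker => b end.

(* The minimum encodes that a player claims all remaining edges when there are
   fewer of them than his bias. *)
Definition legal_move (a b : nat) (h : history) (X : move) : Prop :=
  X \subset free_edges h /\ #|X| = minn (bias a b (turn (size h))) #|free_edges h|.

(* Once the board is exhausted, the only legal move is the empty one, so
   prolonging a finished play changes nothing. *)
Definition legal_history (a b : nat) (h : history) : Prop :=
  forall i, i < size h -> legal_move a b (take i h) (nth set0 h i).

Definition finished (h : history) : Prop := free_edges h = set0.

Definition maker_edges (h : history) : {set {set 'I_n}} :=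
  \bigcup_(i < size h | odd i) nth set0 h i.

(* c lists the vertices in cyclic order; for n <= 2, K_n has no Hamilton
   cycle. *)
Definition contains_hamilton_cycle (M : {set {set 'I_n}}) : Prop :=
  2 < n /\
  exists c : seq 'I_n,
    ucycle (fun x y => [set x; y] \in M) c /\ size c = n.

Definition won_by (p : player) (h : history) : Prop :=
  match p with
  | Maker => contains_hamilton_cycle (maker_edges h)
  | Breaker => ~ contains_hamilton_cycle (maker_edges h)
  end.

Definition strategy := history -> move.

Definition follows (p : player) (s : strategy) (h : history) : Prop :=
  forall i, i < size h -> turn i = p -> nth set0 h i = s (take i h).

Definition legal_strategy (a b : nat) (p : player) (s : strategy) : Prop :=
  forall h, legal_history a b h -> turn (size h) = p -> legal_move a b h (s h).

Definition winning_strategy (a b : nat) (p : player) (s : strategy) : Prop :=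
  legal_strategy a b p s /\
  forall h, legal_history a b h -> finished h -> follows p s h -> won_by p h.

End Game.

(* Player p wins the (a:b) Hamiltonicity game on K_n, Breaker moving first. *)
Definition wins (p : player) (n a b : nat) : Prop :=
  exists s : strategy n, winning_strategy a b p s.

(* Main.v *)
Require Import Defs.
From mathcomp Require Import boolp classical_sets reals topology normedtype.
From mathcomp Require Import landau sequences exp.
From mathcomp Require Import all_boot all_order all_algebra zify ring lra.

(** Only one real-variable threshold matters: [b] against [an/(a + ln n)], with
    no hypothesis on [a]; for [a] of order at least [sqrt (n / ln n)], which
    dominates [ln n], this threshold is [(1 - o(1)) n].

    Breaker isolates a vertex.  Against a huge bias he does so at once.
    Otherwise [a = O(ln n)], and he first builds a clique of [1 + ja], about
    [n / ln^2 n], vertices untouched by Maker, adding [a + 1] vertices per round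
    of which Maker spoils at most [a].  The stars at these vertices are then
    boxes of which Maker destroys at most [a] per round, and filling them evenly
    exhausts one of them, because [b (1 + 1/(1+a) + ... + 1/(1+ja)) > n].

    Maker first builds a sparse expander, giving each vertex [5] out-edges.  He
    treats Breaker's [b] edges as [a] instalments of [b/a] and answers each by
    an edge at a vertex [v] maximising the danger
    [expR (lambda * d v) * delta ^+ (number of out-edges of v)]; the sum of the
    dangers never increases, so Breaker's degree at [v] stays below [(1 - c) n]
    while [v] needs edges.  Breaker's edges contribute to two degrees, but
    counting only the edges between a vertex of linear degree and one of small
    degree changes degrees by a small multiple of [n].  The other end of
    Maker's edge is chosen by the method of conditional expectations, so as to
    keep small the expected number of pairs [A], [S] with [#|S| = 3 * #|A|]
    such that all out-edges of [A] end in [S].  By Posa's rotations a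
    non-Hamiltonian expander then has quadratically many boosters, more than
    Breaker has edges, and [n + 1] of them produce a Hamilton cycle. *)

Set Implicit Arguments.
Unset Strict Implicit.
Unset Printing Implicit Defensive.

(** * From relaxed positions to winning strategies *)

Lemma disjointsU (T : finType) (A B C : {set T}) :
  [disjoint A :|: B & C] = [disjoint A & C] && [disjoint B & C].
Proof. by rewrite !disjoints_subset subUset. Qed.

Lemma ex_subset_card (T : finType) (A F : {set T}) m :
  A \subset F -> #|A| <= m <= #|F| ->
  exists B : {set T}, [/\ A \subset B, B \subset F & #|B| = m].
Proof.
move=> AF /andP[Am mF].
pose B := A :|: [set x in take (m - #|A|) (enum (F :\: A))].
have AE : #|F :\: A| = #|F| - #|A| by rewrite cardsD (setIidPr AF).
have sub : [set x in take (m - #|A|) (enum (F :\: A))] \subset F :\: A.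
  by apply/subsetP=> x; rewrite inE => /mem_take; rewrite mem_enum.
exists B; split; first exact: subsetUl.
- rewrite subUset AF; apply: (subset_trans sub); exact: subsetDl.
rewrite cardsU (_ : A :&: _ = set0); last first.
  apply/setP=> x; rewrite !inE; apply/negbTE/negP=> /andP[xA xt].
  by have /(subsetP sub) : x \in [set x in take (m - #|A|) (enum (F :\: A))];
    rewrite !inE ?xA // => ->.
rewrite cards0 subn0 cardsE (card_uniqP _) ?take_uniq ?enum_uniq //.
by rewrite size_takel -?cardE ?AE; lia.
Qed.

Lemma ex_subset_of_card (T : finType) (F : {set T}) m :
  m <= #|F| -> exists2 B : {set T}, B \subset F & #|B| = m.
Proof.
move=> mF; have [|B [_ BF Bm]] := @ex_subset_card _ set0 F m (sub0set _).
  by rewrite cards0.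
by exists B.
Qed.

Section GameReduction.
Variable n : nat.
Local Notation edgeset := {set {set 'I_n}}.

Definition edges_of (q : bool) (h : history n) : edgeset :=
  \bigcup_(i < size h | odd i == q) nth set0 h i.

Lemma maker_edgesE (h : history n) : maker_edges h = edges_of true h.
Proof. by apply: eq_bigl => i; rewrite eqb_id. Qed.

Lemma edges_of_nil q : edges_of q [::] = set0.
Proof. by rewrite /edges_of big_ord0. Qed.

Lemma edges_of_rcons q h X :
  edges_of q (rcons h X) =
  edges_of q h :|: (if odd (size h) == q then X else set0).
Proof.
rewrite /edges_of big_mkcond size_rcons big_ord_recr /= nth_rcons ltnn eqxx.
congr (_ :|: _); rewrite [RHS]big_mkcond; apply: eq_bigr => i _.
by rewrite nth_rcons ltn_ord.
Qed.

Lemma free_edgesE h :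
  free_edges h = board n :\: (edges_of true h :|: edges_of false h).
Proof.
rewrite /free_edges; congr (_ :\: _).
elim/last_ind: h => [|h X IH]; first by rewrite !edges_of_nil big_nil setU0.
rewrite -cats1 big_cat big_seq1 {}IH cats1 !edges_of_rcons.
by case: (odd _) => /=; rewrite setU0 ?setUA //; rewrite setUAC.
Qed.

Lemma legal_history_rcons a b (h : history n) X :
  legal_history a b (rcons h X) -> legal_history a b h /\ legal_move a b h X.
Proof.
move=> lh; split=> [i ih|].
  have := lh i; rewrite size_rcons ltnS (ltnW ih) => /(_ isT).
  by rewrite -cats1 takel_cat ?(ltnW ih) // nth_cat ih.
have := lh (size h); rewrite size_rcons ltnSn => /(_ isT).
by rewrite -cats1 take_size_cat // nth_cat ltnn subnn.
Qed.

Lemma legal_history_edges a b (h : history n) q : legal_history a b h ->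
  edges_of q h \subset board n /\ [disjoint edges_of q h & edges_of (~~ q) h].
Proof.
elim/last_ind: h q => [|h X IH] q.
  by rewrite !edges_of_nil sub0set -setI_eq0 setI0.
move=> /legal_history_rcons[lh [+ _]]; rewrite free_edgesE subsetD => /andP[Xb Xt].
have [qb qd] := IH q lh.
have Xq : [disjoint edges_of q h & X].
  rewrite disjoint_sym; move: Xt.
  rewrite disjoints_subset setCU finset.subsetI -!disjoints_subset => /andP[].
  by case: (q).
have Xnq : [disjoint X & edges_of (~~ q) h].
  move: Xt; rewrite disjoints_subset setCU finset.subsetI -!disjoints_subset.
  by case/andP; case: (q).
rewrite !edges_of_rcons subUset qb; case: (odd (size h) =P q) => [->|/eqP E].
  have -> : (q == ~~ q) = false by case: (q).
  by rewrite setU0 Xb disjointsU qd.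
have -> : odd (size h) == ~~ q by case: (odd _) E; case: (q).
rewrite sub0set setU0; split => //.
by rewrite disjoint_sym disjointsU ![[disjoint _ & edges_of q h]]disjoint_sym Xq qd.
Qed.

(* [respond k m t]: the player owning [m], against an opponent who owns [t] and
   is about to move, reaches the goal [G] within [k] rounds when moves may be
   smaller than the biases [x] and [y] and may repeat edges already owned. *)
Fixpoint respond (G : edgeset -> Prop) (x y k : nat) (m t : edgeset) : Prop :=
  if k is k'.+1 then
    forall Y : edgeset, Y \subset board n -> [disjoint Y & m] -> #|Y| <= y ->
    exists X : edgeset, [/\ X \subset board n, [disjoint X & t :|: Y],
      #|X| <= x & respond G x y k' (m :|: X) (t :|: Y)]
  else G m.

(** The companion of [respond] with the player himself to move, as Breaker is at the start. *)
Definition lead G x y k (m t : edgeset) :=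
  exists X : edgeset, [/\ X \subset board n, [disjoint X & t],
    #|X| <= x & respond G x y k (m :|: X) t].

Section Reduction.
Variable G : edgeset -> Prop.
Hypothesis G_mono : forall m m' : edgeset, m \subset m' -> G m -> G m'.
Variables x y : nat.

(** A larger [m] leaves the opponent fewer moves, and the old replies still serve. *)
Lemma respond_mono k (m m' t : edgeset) :
  m \subset m' -> respond G x y k m t -> respond G x y k m' t.
Proof.
elim: k m m' t => [|k IH] m m' t mm' /=; first exact: G_mono.
move=> W Y Yb Ym Yy; have [X [Xb Xt Xx WX]] := W Y Yb (disjointWr mm' Ym) Yy.
exists X; split=> //; apply: IH WX; exact: setSU.
Qed.

(** Let the opponent pass in every round: on a full board the replies add nothing to [m], so the
    goal holds already. *)
Lemma respond_full k (m t : edgeset) :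
  board n \subset m :|: t -> respond G x y k m t -> G m.
Proof.
elim: k m t => [//|k IH] m t mt /= W.
have [||//|X [Xb Xt Xx]] := W set0; rewrite ?sub0set ?cards0 //.
  by rewrite -setI_eq0 set0I.
rewrite setU0 in Xt *.
have -> : m :|: X = m.
  apply/setUidPl/subsetP => e eX; have := subsetP mt e (subsetP Xb e eX).
  by rewrite inE (disjointFr Xt eX) orbF.
exact: IH.
Qed.

Lemma lead_full k (m t : edgeset) :
  board n \subset m :|: t -> lead G x y k m t -> G m.
Proof.
move=> mt [X [Xb Xt _]]; have -> : m :|: X = m.
  apply/setUidPl/subsetP => e eX; have := subsetP mt e (subsetP Xb e eX).
  by rewrite inE (disjointFr Xt eX) orbF.
exact: respond_full.
Qed.

End Reduction.

Section Strategy.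
Variable G : edgeset -> Prop.
Hypothesis G_mono : forall m m' : edgeset, m \subset m' -> G m -> G m'.
Variables (a b : nat) (q : bool).

Let p := if q then Maker else Breaker.
Let x := if q then a else b.
Let y := if q then b else a.

Let turnE (h : history n) : turn (size h) = p <-> odd (size h) = q.
Proof. by rewrite /turn /p; case: (odd _); case: (q). Qed.

Let safe (h : history n) (X : edgeset) :=
  exists k, respond G x y k (edges_of q h :|: X) (edges_of (~~ q) h).

Lemma ex_legal_extension (h : history n) (X0 : edgeset) :
  X0 \subset free_edges h -> #|X0| <= bias a b (turn (size h)) ->
  exists2 X, legal_move a b h X & X0 \subset X.
Proof.
move=> X0f X0b.
have [|X [X0X Xf Xc]] := @ex_subset_card _ X0 (free_edges h)
  (minn (bias a b (turn (size h))) #|free_edges h|) X0f.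
  by rewrite leq_min X0b subset_leq_card // geq_minr.
by exists X.
Qed.

Let ex_legal (h : history n) : exists X, legal_move a b h X.
Proof.
have [||X lX _] := @ex_legal_extension h set0; rewrite ?sub0set ?cards0 //.
by exists X.
Qed.

(** The fallback to an arbitrary legal move makes the strategy legal on every history, also on those
    that it never reaches. *)
Definition reply (h : history n) : edgeset :=
  if pselect (exists X, legal_move a b h X /\ safe h X) is left e
  then projT1 (cid e) else projT1 (cid (ex_legal h)).

Let reply_legal h : legal_move a b h (reply h).
Proof.
rewrite /reply; case: pselect => [e|_]; first by case: (cid e) => X [].
by case: cid.
Qed.

(** The relaxed move, stripped of edges already owned, is padded to a legal one; by [respond_mono]
    the additional edges do no harm. *)
Let reply_safe k h : odd (size h) = q ->
  lead G x y k (edges_of q h) (edges_of (~~ q) h) -> safe h (reply h).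
Proof.
move=> hq [X [Xb Xt Xx W]]; rewrite /reply; case: pselect => [e|ne].
  by case: (cid e) => X' [].
case: ne.
have [||X' lX' XX'] := @ex_legal_extension h (X :\: edges_of q h).
- rewrite free_edgesE; apply/subsetP => e; rewrite !inE => /andP[enm eX].
  have := subsetP Xb _ eX; rewrite inE => ->; rewrite andbT negb_or.
  have := disjointFr Xt eX; case: (q) enm => /= -> ->; by [].
- apply: leq_trans (subset_leq_card (subsetDl _ _)) _; apply: (leq_trans Xx).
  by rewrite /x /turn hq; case: (q).
exists X'; split=> //; exists k; apply: respond_mono W => //.
rewrite subUset subsetUl /=; apply/subsetP => e eX; rewrite inE.
by have := subsetP XX' e; rewrite !inE eX andbT; case: (e \in _) => //= ->.
Qed.

Hypothesis start : if q then exists k, respond G x y k set0 set0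
                   else exists k, lead G x y k set0 set0.

Let invariant h : legal_history a b h -> follows p reply h ->
  exists k, (if odd (size h) == q then lead G x y k else respond G x y k)
    (edges_of q h) (edges_of (~~ q) h).
Proof.
elim/last_ind: h => [|h X IH] lh fh.
  by rewrite !edges_of_nil /=; case: (q) start.
have [{}/IH IH [+ Xc]] := legal_history_rcons lh.
have {IH}[|k W] := IH.
  move=> i ih tp; have := fh i; rewrite size_rcons ltnS (ltnW ih).
  by rewrite -cats1 nth_cat ih takel_cat ?(ltnW ih) // => /(_ isT tp).
rewrite free_edgesE subsetD => /andP[Xb Xt].
have {}Xt q' : [disjoint X & edges_of q' h].
  move: Xt; rewrite disjoints_subset setCU finset.subsetI -!disjoints_subset.
  by case/andP; case: (q').
rewrite !edges_of_rcons size_rcons /=; have [hq|hq] := boolP (odd (size h) == q).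
  rewrite hq in W; have hq' := eqP hq.
  have -> : (~~ odd (size h) == q) = false by rewrite hq'; case: (q).
  have -> : (odd (size h) == ~~ q) = false by rewrite hq'; case: (q).
  rewrite setU0; have := fh (size h); rewrite size_rcons ltnSn => /(_ isT).
  rewrite -cats1 nth_cat ltnn subnn take_size_cat //= => -> //; last exact/turnE.
  exact: (reply_safe hq' W).
rewrite (negbTE hq) in W.
have -> : (~~ odd (size h) == q) by case: (odd _) hq; case: (q).
have -> : (odd (size h) == ~~ q) by case: (odd _) hq; case: (q).
rewrite setU0; case: k W => [|k] /= W.
  (* The goal has been reached; the rest of the play is carried by empty relaxed moves. *)
  exists 0; exists set0; rewrite sub0set cards0 setU0; split=> //.
  by rewrite -setI_eq0 set0I.
exists k; apply: W => //.
suff -> : y = bias a b (turn (size h)) by rewrite Xc geq_minl.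
by rewrite /y /turn; case: (odd _) hq; case: (q).
Qed.

Hypothesis G_wins : forall h : history n,
  legal_history a b h -> G (edges_of q h) -> won_by p h.

Lemma wins_of_respond : wins p n a b.
Proof.
exists reply; split=> [h _ _|h lh fh sh]; first exact: reply_legal.
apply: G_wins => //; have [k] := invariant lh sh.
have full : board n \subset edges_of q h :|: edges_of (~~ q) h.
  move: fh; rewrite /finished free_edgesE => /eqP; rewrite finset.setD_eq0.
  by case: (q) => //; rewrite setUC.
case: eqP => _; first exact: lead_full.
exact: respond_full.
Qed.

End Strategy.

Lemma contains_hamilton_cycle_mono (M M' : edgeset) :
  M \subset M' -> contains_hamilton_cycle M -> contains_hamilton_cycle M'.
Proof.
move=> MM' [n2 [c [/andP[cc uc] sc]]]; split=> //; exists c; split=> //.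
apply/andP; split=> //; apply: sub_cycle cc => u v /=; exact: (subsetP MM').
Qed.

Lemma maker_wins_of_respond a b k :
  respond (@contains_hamilton_cycle n) a b k set0 set0 -> wins Maker n a b.
Proof.
move=> W; apply: (@wins_of_respond (@contains_hamilton_cycle n)
  contains_hamilton_cycle_mono a b true).
  by exists k.
by move=> h _ /=; rewrite maker_edgesE.
Qed.

Definition isolating (B : edgeset) :=
  exists v : 'I_n, forall w, w != v -> [set v; w] \in B.

(** A Hamilton cycle visits the isolated vertex, and its edge there would belong to both players. *)
Lemma breaker_wins_of_lead a b k :
  lead isolating b a k set0 set0 -> wins Breaker n a b.
Proof.
move=> W; apply: (@wins_of_respond isolating _ a b false).
- by move=> m m' mm' [v vm]; exists v => w /vm; exact: (subsetP mm').
- by exists k.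
move=> h lh [v vB] /= [n2 [c [/andP[cc uc] sc]]].
have [+ dB] := legal_history_edges true lh; rewrite -maker_edgesE => Mb.
have vc : v \in c.
  have : #|c| = #|'I_n| by rewrite card_ord (card_uniqP uc).
  move/eqP; rewrite eq_sym => /eqP E.
  by have /subset_cardP := esym E; move=> /(_ (subset_predT _)) ->.
have := next_cycle cc vc; set w := next c v => vw.
have := subsetP Mb _ vw; rewrite inE cards2 => vNw.
have wv : w != v by rewrite eq_sym; case: (v != w) vNw.
rewrite maker_edgesE in vw.
by have := disjointFr dB vw; rewrite /= vB.
Qed.

End GameReduction.

(** * Rotations and boosters *)

Section Posa.
Variables (V : finType) (v0 : V).

Definition gpath (g : rel V) (s : seq V) := uniq s && sorted g s.

Definition neighbourhood (g : rel V) (A : {set V}) : {set V} :=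
  [set w | [exists v in A, g v w]].

(** Equivalently, [A] has more than [2 * #|A|] neighbours outside itself, which is what Posa's lemma
    contradicts. *)
Definition expander (g : rel V) k := forall A : {set V},
  0 < #|A| <= k -> 3 * #|A| < #|A :|: neighbourhood g A|.

Definition longest (g : rel V) s :=
  gpath g s /\ forall t, gpath g t -> size t <= size s.

(** Posa's rotation: the path edge entering position [i] is given up for an edge from position
    [i.-1] to the last vertex. For [0 < i] the first vertex stays fixed. *)
Definition rotation i (s : seq V) := take i s ++ rev (drop i s).

Lemma size_rotation i s : size (rotation i s) = size s.
Proof. by rewrite size_cat size_rev -size_cat cat_take_drop. Qed.

Lemma perm_rotation i s : perm_eq (rotation i s) s.
Proof.
by rewrite -[X in perm_eq _ X](cat_take_drop i) perm_cat2l perm_rev.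
Qed.

Lemma nth_rotation i s j : i <= size s -> j < size s ->
  nth v0 (rotation i s) j =
  nth v0 s (if j < i then j else (size s).-1 - (j - i)).
Proof.
move=> is_ js; rewrite nth_cat size_takel //; case: ltnP => ij.
  by rewrite nth_take.
rewrite nth_rev ?size_drop ?nth_drop; last by lia.
by congr nth; lia.
Qed.

Inductive reach (g : rel V) (s : seq V) : seq V -> Prop :=
| reach_refl : reach g s s
| reach_rot t i : reach g s t -> 0 < i < size t ->
    g (nth v0 t i.-1) (last v0 t) -> reach g s (rotation i t).

Definition ends g s : {set V} :=
  [set y | `[< exists2 t, reach g s t & last v0 t = y >]].

Lemma endsP g s y : reflect (exists2 t, reach g s t & last v0 t = y) (y \in ends g s).
Proof. by rewrite inE; exact: asboolP. Qed.

Definition adjacent (s : seq V) u v := exists2 i, i.+1 < size s &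
  (u = nth v0 s i /\ v = nth v0 s i.+1) \/ (v = nth v0 s i /\ u = nth v0 s i.+1).

Variable g : rel V.
Hypothesis g_sym : symmetric g.

Lemma sorted_rotation s i : 0 < i < size s -> sorted g s ->
  g (nth v0 s i.-1) (last v0 s) -> sorted g (rotation i s).
Proof.
move=> /andP[i0 si] /(sortedP v0) ss; rewrite -nth_last => gi.
apply/(sortedP v0) => j; rewrite size_rotation => js.
rewrite !nth_rotation; try lia.
case: (ltngtP j.+1 i) => ji.
- exact: ss.
- rewrite g_sym.
  have -> : (size s).-1 - (j - i) = ((size s).-1 - (j.+1 - i)).+1 by lia.
  by apply: ss; lia.
by rewrite ji subnn subn0 -[j]/(j.+1.-1) ji.
Qed.

Lemma reach_longest s t : longest g s -> reach g s t ->
  [/\ longest g t, perm_eq t s & (forall x, head x t = head x s)].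
Proof.
move=> ls; elim=> {t} [//|t i _ [[/andP[ut st] mt] pt ht] it gi].
split.
- split; last by move=> t' /mt; rewrite size_rotation.
  by rewrite /gpath (perm_uniq (perm_rotation _ _)) ut sorted_rotation.
- exact: perm_trans (perm_rotation _ _) pt.
move=> x; rewrite -ht; case: t i it {gi ut st mt pt ht} => [|y t] [|i] //.
Qed.

(** A rotation separates only one consecutive pair, and the second vertex of that pair becomes the
    new end of the path. *)
Lemma reach_adjacent s t u v : reach g s t -> uniq s -> adjacent s u v ->
  u \notin ends g s -> v \notin ends g s -> adjacent t u v.
Proof.
move=> rt us suv uE vE; elim: rt => {t} [//|t i rt [j jt tuv] /andP[i0 it] gi].
have iE : nth v0 t i \in ends g s.
  apply/endsP; exists (rotation i t).
    by apply: reach_rot => //; rewrite i0.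
  rewrite -nth_last size_rotation nth_rotation; try lia.
  have -> : ((size t).-1 < i) = false by lia.
  by congr nth; lia.
have [ji|ji|ji] := ltngtP j.+1 i.
- exists j; first by rewrite size_rotation.
  rewrite !nth_rotation; try lia.
  by have [-> ->] : j < i /\ j.+1 < i by lia.
- exists ((size t).-1 - j.+1 + i); first by rewrite size_rotation; lia.
  rewrite !nth_rotation; try lia.
  have -> : ((size t).-1 - j.+1 + i < i) = false by lia.
  have -> : (((size t).-1 - j.+1 + i).+1 < i) = false by lia.
  have -> : (size t).-1 - ((size t).-1 - j.+1 + i - i) = j.+1 by lia.
  have -> : (size t).-1 - (((size t).-1 - j.+1 + i).+1 - i) = j by lia.
  by case: tuv => [[-> ->]|[-> ->]]; [right|left].
by case: tuv => [[_ E]|[_ E]]; move: iE; rewrite -ji -E ?(negbTE uE) ?(negbTE vE).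
Qed.

Lemma longest_last_neighbour s w : longest g s -> 0 < size s ->
  g (last v0 s) w -> w \in s.
Proof.
move=> [/andP[us ss] ms] s0 gw; apply/negPn/negP=> ws.
have := ms (rcons s w); rewrite size_rcons ltnn => /(_ _)/negP; apply=> //.
rewrite /gpath rcons_uniq ws us /=; case: s s0 ss gw {us ws ms} => // x s _ /= ss gw.
by rewrite rcons_path ss.
Qed.

(** Posa's lemma: a neighbour of an end is an end itself or lies beside an end on [s]. So the ends
    and their neighbours number at most three times the ends, and expansion forbids this for a set
    of at most [k] vertices. *)
Lemma posa_ends s k : longest g s -> 0 < size s -> expander g k -> 0 < k ->
  k < #|ends g s|.
Proof.
move=> ls s0 ge k0; rewrite ltnNge; apply/negP=> Ek; set E := ends g s in Ek.
have us : uniq s by case: ls => /andP[].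
have E0 : 0 < #|E|.
  apply/card_gt0P; exists (last v0 s); apply/endsP; exists s => //; exact: reach_refl.
have := ge E; rewrite E0 Ek => /(_ isT); apply/negP; rewrite -leqNgt.
pose nx y := nth v0 s (index y s).+1; pose pv y := nth v0 s (index y s).-1.
have sub : E :|: neighbourhood g E \subset E :|: (nx @: E :|: pv @: E).
  rewrite subUset subsetUl /=; apply/subsetP=> u.
  rewrite inE => /existsP[y /andP[yE gyu]]; rewrite inE.
  have [//|uE /=] := boolP (u \in E).
  have /endsP[t rt ty] := yE; have [lt pt ht] := reach_longest ls rt.
  have ut : u \in t by apply: (longest_last_neighbour lt);
    rewrite ?(perm_size pt) ?ty.
  have us' : u \in s by rewrite -(perm_mem pt).
  have unt : uniq t by rewrite (perm_uniq pt).
  have st : size t = size s by rewrite (perm_size pt).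
  set j := index u t; set i := index u s.
  have jt : j < size t by rewrite index_mem.
  have is_ : i < size s by rewrite index_mem.
  have uj : nth v0 t j = u by rewrite nth_index.
  have ui : nth v0 s i = u by rewrite nth_index.
  have jN : j.+1 < size t.
    rewrite ltn_neqAle jt andbT; apply/eqP=> E1; move: uE.
    by rewrite -uj (_ : j = (size t).-1) ?nth_last ?ty ?yE // -E1.
  (* Rotating along the edge between [u] and the end [y] of [t] makes the successor of [u] an
     end. *)
  have zE : nth v0 t j.+1 \in E.
    apply/endsP; exists (rotation j.+1 t).
      by apply: reach_rot => //=; rewrite uj ty g_sym.
    rewrite -nth_last size_rotation nth_rotation; try lia.
    have -> : ((size t).-1 < j.+1) = false by lia.
    by congr nth; lia.
  have iN : i.+1 < size s.
    rewrite ltn_neqAle is_ andbT; apply/eqP=> E1; move: uE.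
    rewrite -ui (_ : i = (size s).-1) ?nth_last -?E1 //; case/negP.
    apply/endsP; exists s => //; exact: reach_refl.
  apply/negPn/negP; rewrite inE negb_or => /andP[unx upv].
  have nE : nth v0 s i.+1 \notin E.
    apply: contra upv => zs; apply/imsetP; exists (nth v0 s i.+1) => //.
    by rewrite /pv index_uniq.
  have pE : 0 < i -> nth v0 s i.-1 \notin E.
    move=> i0; apply: contra unx => zs; apply/imsetP; exists (nth v0 s i.-1) => //.
    have i1 : i.-1 < size s := leq_ltn_trans (leq_pred _) is_.
    rewrite /nx index_uniq //.
    by rewrite prednK.
  (* If neither neighbour of [u] on [s] is an end, both stay beside [u] on [t]. The successor there
     is an end, so both would be the predecessor, which is absurd. *)
  have adjt v : adjacent t u v -> v \notin E -> v = nth v0 t j.-1 /\ 0 < j.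
    move=> [l lt' [[e1 e2]|[e1 e2]]] vE.
      have lj : l = j.
        by rewrite /j e1 index_uniq // ltnW.
      by move: vE; rewrite e2 lj zE.
    have lj : l.+1 = j.
      by rewrite /j e2 index_uniq.
    by rewrite -lj.
  have [a1 j0] : nth v0 s i.+1 = nth v0 t j.-1 /\ 0 < j.
    apply: (adjt) => //; apply: (reach_adjacent rt) => //.
    by exists i => //; left; rewrite ui.
  have i0 : 0 < i.
    rewrite lt0n; apply/eqP=> i0; have := ht v0; rewrite -!nth0.
    have -> : nth v0 s 0 = u by rewrite -ui i0.
    by move=> u0; move: j0; rewrite /j -u0 index_uniq // (leq_ltn_trans _ jt).
  have [a2 _] : nth v0 s i.-1 = nth v0 t j.-1 /\ 0 < j.
    apply: (adjt); rewrite ?pE //; apply: (reach_adjacent rt) => //; last exact: pE.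
    by exists i.-1; rewrite ?prednK //; right; rewrite ui.
  have i1 : i.-1 < size s := leq_ltn_trans (leq_pred _) is_.
  by move/eqP: a1; rewrite -a2 nth_uniq //; move/eqP; lia.
apply: leq_trans (subset_leq_card sub) _.
apply: leq_trans (leq_card_setU _ _) _.
have c1 : #|nx @: E :|: pv @: E| <= #|E| + #|E|.
  by apply: leq_trans (leq_card_setU _ _) _; rewrite leq_add ?leq_imset_card.
by lia.
Qed.

End Posa.

(** * Boosters of an expander *)

Section Boosters.
Variables (V : finType) (g : rel V) (k : nat).
Hypotheses (g_sym : symmetric g) (g_exp : expander g k) (k_gt0 : 0 < k).

(** Meant for [n] the size of a longest path: the pair [y], [z] is a booster, closing a Hamilton
    cycle or giving a longer path. *)
Definition boosts n y z := z != y /\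
  forall g' : rel V, symmetric g' -> subrel g g' -> g' y z ->
    (exists2 c, ucycle g' c & size c = #|V|) \/
    (exists2 t, gpath g' t & size t = n.+1).

Lemma longest_rev s : longest g s -> longest g (rev s).
Proof.
move=> [/andP[us ss] ms]; split=> [|t]; last by rewrite size_rev; exact: ms.
rewrite /gpath rev_uniq us rev_sorted; apply: sub_sorted ss => x y.
by rewrite g_sym.
Qed.

(** For each end [y] the reversed path is rotated with [y] fixed, giving more than [k] vertices [z]
    such that the edge [y z] closes a cycle on the vertices of [s]. If an edge leaves this cycle,
    opening it there gives a longer path. If none does and [s] is not spanning, the vertices off [s]
    are closed under neighbours, hence more than [k] in number, and joining [y] to any of them
    prolongs the path. *)
Lemma ex_boosters s : longest g s -> 0 < size s ->
  exists2 E : {set V}, k < #|E| & forall y, y \in E ->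
  exists2 Z : {set V}, k < #|Z| & forall z, z \in Z -> boosts (size s) y z.
Proof.
move=> ls s0; have v0 : V by case: s s0 {ls}.
exists (ends v0 g s); first exact: posa_ends.
have kE := posa_ends v0 g_sym ls s0 g_exp k_gt0.
have s1 : 1 < size s.
  apply: leq_ltn_trans k_gt0 _; apply: leq_trans kE _.
  rewrite -(card_uniqP _); last by case: ls => /andP[].
  apply/subset_leq_card/subsetP => y /endsP[t rt <-].
  have [_ pt _] := reach_longest g_sym ls rt.
  by rewrite -(perm_mem pt) -nth_last mem_nth // (perm_size pt) ltn_predL.
move=> y /endsP[t rt ty]; have [lt pt _] := reach_longest g_sym ls rt.
have lr := longest_rev lt.
have pr : perm_eq (rev t) s by rewrite perm_rev.
have close z : z \in ends v0 g (rev t) -> z != y /\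
    forall g' : rel V, symmetric g' -> subrel g g' -> g' y z ->
    exists2 c, ucycle g' c & perm_eq c s.
  move=> /endsP[t' rt' tz].
  have [[/andP[ut' st'] _] pt' ht'] := reach_longest g_sym lr rt'.
  have pt's := perm_trans pt' pr.
  have := ht' v0; have := perm_size pt's.
  have -> : head v0 (rev t) = y.
    by rewrite -nth0 nth_rev ?subn1 ?nth_last // (perm_size pt).
  case: t' ut' st' tz {rt' ht' pt'} pt's => [|y' r] /=; first by move: s1; case: (s).
  move=> /andP[yr ur] yp rz pt's szr yy; subst y'.
  split.
    apply: contraNneq yr => <-; rewrite -rz; case: r szr {yp ur rz pt's} => [E|x r _].
      by rewrite -E in s1.
    by rewrite /= mem_last.
  move=> g' g's gg' gyz; exists (y :: r) => //; rewrite /ucycle /= yr ur !andbT.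
  by rewrite rcons_path (sub_path gg' yp) rz g's.
have [full|nfull] := eqVneq (size s) #|V|.
  exists (ends v0 g (rev t)).
    by apply: posa_ends; rewrite ?size_rev ?(perm_size pt).
  move=> z /close[zy cz]; split=> // g' g's gg' gyz; left.
  by have [c cc /perm_size cs] := cz g' g's gg' gyz; exists c; rewrite ?cs.
have [/existsP[u /andP[us /existsP[w /andP[ws guw]]]]|noedge] :=
    boolP [exists u, (u \in s) && [exists w, (w \notin s) && g u w]].
  exists (ends v0 g (rev t)).
    by apply: posa_ends; rewrite ?size_rev ?(perm_size pt).
  move=> z /close[zy cz]; split=> // g' g's gg' gyz; right.
  have [c /andP[cc uc] cs] := cz g' g's gg' gyz.
  have /rot_to[i r Er] : u \in c by rewrite (perm_mem cs).
  exists (w :: u :: r); last by rewrite /= -(perm_size cs) -(size_rot i c) Er.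
  move: cc uc ws; rewrite -(rot_cycle i) -(rot_uniq i) Er => cc uc ws.
  have wr : w \notin u :: r by rewrite -Er mem_rot (perm_mem cs).
  rewrite /gpath cons_uniq wr uc /= g's (gg' _ _ guw) /=.
  by move: cc; rewrite /= rcons_path => /andP[].
pose Z := ~: [set x in s]; exists Z.
  rewrite ltnNge; apply/negP=> Zk.
  have Z0 : 0 < #|Z|.
    have := cardsC [set x in s].
    rewrite cardsE (card_uniqP _); last by case: ls => /andP[].
    by rewrite -/Z; move/eqP: nfull; lia.
  have := g_exp (A := Z); rewrite Z0 Zk => /(_ isT).
  rewrite (_ : Z :|: neighbourhood g Z = Z); first by lia.
  apply/setUidPl/subsetP=> u; rewrite inE => /existsP[w /andP[wZ gwu]].
  rewrite !inE in wZ *; apply: contra noedge => us.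
  by apply/existsP; exists u; rewrite us; apply/existsP; exists w; rewrite wZ g_sym.
move=> z zs; rewrite !inE in zs.
have yt : y \in t by rewrite -ty -nth_last mem_nth // (perm_size pt) ltn_predL.
split; first by apply: contraNneq zs => ->; rewrite -(perm_mem pt).
move=> g' g's gg' gyz; right; exists (rcons t z); last by rewrite size_rcons (perm_size pt).
have [/andP[ut st] _] := lt.
rewrite /gpath rcons_uniq (perm_mem pt) zs ut /=.
have := perm_size pt; case: t ty st {rt pt lt lr pr close yt ut} => [|x t] /= ty st szt.
  by [].
by rewrite rcons_path (sub_path gg' st) ty.
Qed.

Lemma ex_longest : exists s, longest g s.
Proof.
pose P m := [exists t : m.-tuple V, gpath g t].
have exP : exists m, P m by exists 0; apply/existsP; exists [tuple].
have ubP m : P m -> m <= #|V|.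
  move=> /existsP[t /andP[ut _]]; rewrite -(size_tuple t) -(card_uniqP ut).
  exact: max_card.
case: (ex_maxnP exP ubP) => m /existsP[t gt] mm; exists t; split=> // t' gt'.
by rewrite size_tuple; apply: mm; apply/existsP; exists (in_tuple t').
Qed.

End Boosters.

(** * Degrees in edge sets and a single boosting move *)

Section Boost.
Variable n : nat.
Local Notation edgeset := {set {set 'I_n}}.

Definition erel (M : edgeset) : rel 'I_n := fun x y => [set x; y] \in M.

Lemma erel_sym M : symmetric (erel M).
Proof. by move=> x y; rewrite /erel setUC. Qed.

Definition deg (B : edgeset) v := #|[set u | erel B v u]|.

Lemma card2_other (e : {set 'I_n}) v : #|e| = 2 -> v \in e ->
  exists2 w, w != v & e = [set v; w].
Proof.
move=> /eqP/cards2P[x [y [xy ->]]]; rewrite !inE => /orP[]/eqP->.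
  by exists y; rewrite // eq_sym.
by exists x => //; rewrite setUC.
Qed.

Lemma deg_edges (B : edgeset) v : B \subset board n ->
  deg B v = #|[set e in B | v \in e]|.
Proof.
move=> Bb; rewrite /deg -(card_in_imset (f := fun u => [set v; u])).
  congr #|pred_of_set _|; apply/setP=> e; rewrite !inE.
  apply/imsetP/andP => [[u]|[eB ve]].
    by rewrite inE /erel => uB ->; rewrite !inE eqxx.
  have e2 : #|e| = 2 by apply/eqP; have := subsetP Bb e eB; rewrite inE.
  by have [w _ E] := card2_other e2 ve; exists w; rewrite ?inE /erel -?E.
move=> u w _ _ /= E.
have : u \in [set v; w] by rewrite -E !inE eqxx orbT.
rewrite !inE => /orP[/eqP uv|/eqP//].
have : w \in [set v; u] by rewrite E !inE eqxx orbT.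
by rewrite !inE uv orbb => /eqP.
Qed.

Lemma handshake (B : edgeset) : B \subset board n ->
  \sum_v deg B v = 2 * #|B|.
Proof.
move=> Bb.
have degE v : deg B v = \sum_(e in B) (v \in e).
  by rewrite (deg_edges _ Bb) -sum1dep_card big_mkcondr.
under eq_bigr do rewrite degE; rewrite exchange_big /=.
rewrite mulnC -sum_nat_const; apply: eq_bigr => e eB.
rewrite -big_mkcond /= sum1_card; by have := subsetP Bb e eB; rewrite inE => /eqP.
Qed.

(** At least [k.+1 ^ 2] ordered pairs are boosters, while [B] accounts for only [2 * #|B|] ordered
    pairs; so some booster avoids [B]. *)
Lemma boost_step (M B : edgeset) k j :
  B \subset board n -> expander (erel M) k -> 0 < k -> 2 < n ->
  2 * #|B| < k.+1 ^ 2 ->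
  (contains_hamilton_cycle M \/ exists2 t, gpath (erel M) t & j <= size t) ->
  exists e : edgeset, [/\ e \subset board n, [disjoint e & B], #|e| <= 1 &
   contains_hamilton_cycle (M :|: e) \/ exists2 t, gpath (erel (M :|: e)) t &
     j.+1 <= size t].
Proof.
move=> Bb ge k0 n2 Bk [hM|[t0 gt0 jt0]].
  by exists set0; rewrite sub0set cards0 setU0 -setI_eq0 set0I; split=> //; left.
have [s ls] := ex_longest (erel M).
have v0 : 'I_n by exists 0; lia.
have s0 : 0 < size s by apply: leq_trans (ls.2 [:: v0] _).
have [E kE HE] := ex_boosters (erel_sym M) ge k0 ls s0.
have [y yE [z yz zB]] : exists2 y, y \in E & exists2 z,
    boosts (erel M) (size s) y z & [set y; z] \notin B.
  apply: contrapT => H; move: Bk; rewrite ltnNge => /negP; apply.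
  rewrite -handshake // (bigID (mem E)) /= (leq_trans _ (leq_addr _ _)) //.
  rewrite (@leq_trans (\sum_(y in E) k.+1)) //.
    by rewrite sum_nat_const expnS expn1 leq_mul2r kE orbT.
  apply: leq_sum => y yE; have [Z kZ HZ] := HE y yE.
  apply: leq_trans kZ (subset_leq_card _); apply/subsetP => z zZ; rewrite inE.
  by apply: contrapT => /negP zB; apply: H; exists y => //; exists z => //; apply: HZ.
exists [set [set y; z]]; have [zy bz] := yz.
split.
- by rewrite sub1set inE cards2 (eq_sym y) zy.
- by rewrite disjoints_subset sub1set inE zB.
- by rewrite cards1.
have sub : subrel (erel M) (erel (M :|: [set [set y; z]])).
  by move=> u v; rewrite /erel inE => ->.
have yzM : erel (M :|: [set [set y; z]]) y z by rewrite /erel !inE eqxx orbT.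
have [[c uc sc]|[t gt st]] := bz _ (erel_sym _) sub yzM.
  by left; split=> //; exists c; rewrite sc card_ord.
by right; exists t => //; rewrite st ltnS (leq_trans jt0) // ls.2.
Qed.
End Boost.

(** * Breaker: cliques and boxes *)

Section BreakerStrategy.
Variables (n a b : nat).
Local Notation edgeset := {set {set 'I_n}}.

Lemma card_bigcup_le (I T : finType) (A : {set I}) (F : I -> {set T}) :
  #|\bigcup_(i in A) F i| <= \sum_(i in A) #|F i|.
Proof.
elim/big_rec2: _ => [|i m B _ IH]; first by rewrite cards0.
by apply: leq_trans (leq_card_setU _ _) _; rewrite leq_add2l.
Qed.

Definition untouched (M : edgeset) (C : {set 'I_n}) :=
  [set u in C | u \notin cover M].

Definition free_at (B : edgeset) (u : 'I_n) := [set e in board n | u \in e] :\: B.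

Definition clique (B : edgeset) (C : {set 'I_n}) :=
  forall e, e \in board n -> e \subset C -> e \in B.

(** As [B] contains all edges inside [C], each edge of [Y] meets [C] in at most one vertex. *)
Lemma card_untouched (B Y : edgeset) (C : {set 'I_n}) :
  clique B C -> Y \subset board n -> [disjoint Y & B] ->
  #|C| - #|Y| <= #|untouched Y C|.
Proof.
move=> cC Yb YB.
have tE : C :\: untouched Y C \subset \bigcup_(e in Y) (C :&: e).
  apply/subsetP=> u; rewrite !inE negb_and negbK => /andP[/orP[/negbTE->//|+] uC].
  by move=> /bigcupP[e eY ue]; apply/bigcupP; exists e; rewrite // inE uC.
rewrite leq_subLR -(cardsID (untouched Y C) C) addnC leq_add //.
  apply: leq_trans (subset_leq_card tE) _; apply: leq_trans (card_bigcup_le _ _) _.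
  rewrite -sum1_card; apply: leq_sum => e eY.
  have eb := subsetP Yb e eY.
  have e2 : #|e| = 2 by apply/eqP; move: eb; rewrite inE.
  rewrite leqNgt; apply/negP=> ce; have : e \in B.
    apply: cC => //; apply/setIidPr/eqP.
    by rewrite eqEcard subsetIr e2.
  by rewrite (disjointFr YB eY).
by rewrite subset_leq_card // subsetIr.
Qed.

Lemma card_free_at (B : edgeset) u : #|free_at B u| <= n.-1.
Proof.
apply: leq_trans (subset_leq_card (subsetDl _ _)) _.
apply: (@leq_trans #|[set [set u; w] | w in ~: [set u]]|).
  apply/subset_leq_card/subsetP => e; rewrite !inE => /andP[/eqP e2 ue].
  have [w wu ->] := card2_other e2 ue; apply/imsetP; exists w => //.
  by rewrite !inE.
by apply: leq_trans (leq_imset_card _ _) _; rewrite cardsC1 card_ord.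
Qed.

Lemma disjoint_cover (M : edgeset) (C e : {set 'I_n}) u :
  C :&: cover M = set0 -> u \in C -> u \in e -> e \notin M.
Proof.
move=> CM uC ue; apply/negP=> eM.
have : u \in C :&: cover M by rewrite inE uC; apply/bigcupP; exists e.
by rewrite CM inE.
Qed.

(** Up to [q] free edges are taken from the star at each vertex of [C]. The parts may overlap, which
    only lowers the cost, and none is Maker's since [M] does not touch [C]. *)
Lemma ex_box_move q (C : {set 'I_n}) (B M : edgeset) :
  C :&: cover M = set0 ->
  exists X : edgeset, [/\ X \subset board n, [disjoint X & M], #|X| <= #|C| * q &
    forall u, u \in C -> #|free_at (B :|: X) u| <= #|free_at B u| - q].
Proof.
move=> CM.
have /choice[F HF] : forall u, exists Xu : edgeset,
    Xu \subset free_at B u /\ #|Xu| = minn q #|free_at B u|.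
  move=> u; have [Xu sX cX] := ex_subset_of_card (geq_minr q #|free_at B u|).
  by exists Xu.
exists (\bigcup_(u in C) F u); split.
- apply/bigcupsP=> u _; apply: (subset_trans (HF u).1).
  by apply: subset_trans (subsetDl _ _) _; apply/subsetP=> e; rewrite inE => /andP[].
- rewrite disjoints_subset; apply/bigcupsP=> u uC; apply/subsetP=> e /(subsetP (HF u).1).
  by rewrite !inE => /andP[_ /andP[_ ue]]; exact: disjoint_cover CM uC ue.
- apply: leq_trans (card_bigcup_le _ _) _; rewrite -sum_nat_const.
  by apply: leq_sum => u _; rewrite (HF u).2 geq_minl.
move=> u uC; have [sF cF] := HF u.
apply: (@leq_trans #|free_at B u :\: F u|).
  apply/subset_leq_card/subsetP=> e; rewrite !inE negb_or => /andP[/andP[-> eF] ->].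
  by rewrite !andbT; apply: contra eF => eFu; apply/bigcupP; exists u.
by rewrite cardsD (setIidPr sF) cF; lia.
Qed.

Lemma sub_clique (B B' : edgeset) (C C' : {set 'I_n}) :
  B \subset B' -> C' \subset C -> clique B C -> clique B' C'.
Proof.
by move=> BB CC cC e eb eC; apply/(subsetP BB)/cC => //; exact: subset_trans CC.
Qed.

Lemma untouched_cover (M Y : edgeset) (C : {set 'I_n}) :
  C :&: cover M = set0 -> untouched Y C :&: cover (M :|: Y) = set0.
Proof.
move=> CM; apply/setP=> u; rewrite !inE; apply/negbTE/negP.
move=> /andP[/andP[uC uY] /bigcupP[e]]; rewrite inE => /orP[eM|eY] ue.
  by have := disjoint_cover CM uC ue; rewrite eM.
by case/negP: uY; apply/bigcupP; exists e.
Qed.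

(** The box game on the stars at [C]: [b] edges are spread evenly over [1 + j * a] stars, and
    Maker's answer spoils at most [a] of these. When one star is left, it has at most [b] free edges
    and is completed. *)
Lemma box_lead j (C : {set 'I_n}) (B M : edgeset) :
  1 + j * a <= #|C| -> C :&: cover M = set0 -> clique B C ->
  (forall u, u \in C -> #|free_at B u| <= \sum_(i < j.+1) b %/ (1 + i * a)) ->
  lead (@isolating n) b a j B M.
Proof.
elim: j C B M => [|j IH] C B M jC CM cC fC.
(* With exactly [1 + j * a] stars, the share of each is the last term of the sum. *)
all: have [C0 C0C cC0] := ex_subset_of_card jC.
all: have C0M : C0 :&: cover M = set0 by
  apply/eqP; rewrite -finset.subset0 -CM finset.setSI.
all: have [X [Xb XM cX fX]] := ex_box_move (b %/ #|C0|) B C0M.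
all: exists X; split=> //; first by rewrite (leq_trans cX) // mulnC leq_divM.
  have [u uC] : exists u, u \in C0 by apply/card_gt0P; rewrite cC0.
  have := fX u uC; have := fC u (subsetP C0C u uC); rewrite big_ord1 cC0 divn1.
  rewrite -subn_eq0 => /eqP->; rewrite leqn0 cards_eq0 => /eqP f0.
  exists u => w wu; apply: contraFT (finset.in_set0 [set u; w]) => nB.
  by rewrite -f0 in_setD nB !inE cards2 (eq_sym u) wu eqxx.
move=> Y Yb YB cY.
have cC' : clique (B :|: X) C0 by apply: sub_clique cC; rewrite ?subsetUl.
have := card_untouched cC' Yb YB; rewrite cC0 => cU.
apply: (IH (untouched Y C0)).
- by apply: leq_trans cU; rewrite mulSn; lia.
- exact: untouched_cover.
- by apply: sub_clique cC'; [exact: subxx | apply/subsetP=> u; rewrite inE => /andP[]].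
move=> u; rewrite inE => /andP[uC _]; apply: leq_trans (fX u uC) _.
by have := fC u (subsetP C0C u uC); rewrite big_ord_recr /= cC0; lia.
Qed.

Lemma card_cover_le (M : edgeset) : M \subset board n -> #|cover M| <= 2 * #|M|.
Proof.
move=> Mb; apply: leq_trans (card_bigcup_le _ _) _; rewrite mulnC -sum_nat_const.
by apply: leq_sum => e eM; have := subsetP Mb e eM; rewrite inE => /eqP->.
Qed.

(** In each of the [d] remaining building rounds, [a.+1] fresh vertices are joined to the clique and
    to each other; Maker spoils at most [a] vertices, so the clique gains at least one. The bound
    [#|M| <= a * #|C|] keeps fresh vertices available. *)
Lemma clique_lead d j (C : {set 'I_n}) (B M : edgeset) :
  let m := 1 + j * a in
  a.+1 * (m + a.+1) <= b -> m + 2 * (a * m) + a.+1 <= n ->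
  n.-1 <= \sum_(i < j.+1) b %/ (1 + i * a) ->
  #|C| + d = m -> M \subset board n -> #|M| <= a * #|C| ->
  C :&: cover M = set0 -> clique B C ->
  lead (@isolating n) b a (j + d) B M.
Proof.
move=> m ab mn nb.
elim: d C B M => [|d IH] C B M mC Mb cM CM cC.
  rewrite !addn0 in mC *; apply: (box_lead _ CM cC); first by rewrite mC.
  by move=> u _; exact: leq_trans (card_free_at _ _) nb.
have /ex_subset_of_card[U UT cU] : a.+1 <= #|~: (C :|: cover M)|.
  have := cardsC (C :|: cover M); rewrite card_ord.
  have [+ _] := leq_card_setU C (cover M); have := card_cover_le Mb.
  have : a * #|C| <= a * m by rewrite leq_mul2l -mC leq_addr orbT.
  clearbody m; lia.
have UC u : u \in U -> u \notin C /\ u \notin cover M.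
  by move/(subsetP UT); rewrite !inE negb_or => /andP.
pose C1 := C :|: U.
have cC1 : #|C1| = #|C| + a.+1.
  rewrite cardsU cU (_ : C :&: U = set0) ?cards0 ?subn0 //.
  by apply/setP=> u; rewrite !inE; apply/negbTE/negP=> /andP[+ /UC[/negP]].
have C1M : C1 :&: cover M = set0.
  apply/setP=> u; rewrite [RHS]inE; apply/negbTE/negP; rewrite 2!inE.
  move=> /andP[/orP[uC|/UC[_ /negP//]]].
  by move=> uM; have := finset.in_set0 u; rewrite -CM inE uC uM.
pose X := [set e in board n | e \subset C1] :\: B.
have XU e : e \in X -> exists2 u, u \in U & exists2 w, w \in C1 & e = [set u; w].
  rewrite 2!inE => /andP[eB /andP[eb eC1]].
  have [u ue uC] : exists2 u, u \in e & u \notin C.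
    by apply/subsetPn; apply: contra eB; exact: cC.
  have uU : u \in U by have := subsetP eC1 u ue; rewrite inE (negbTE uC).
  have e2 : #|e| = 2 by apply/eqP; move: eb; rewrite inE.
  have [w _ E] := card2_other e2 ue; exists u => //; exists w => //.
  by apply: (subsetP eC1); rewrite E !inE eqxx orbT.
rewrite addnS; exists X; split.
- by apply/subsetP=> e; rewrite 2!inE => /andP[_ /andP[]].
- rewrite disjoints_subset; apply/subsetP=> e eX; rewrite inE.
  have [u uU [w _ ->]] := XU e eX.
  apply: (disjoint_cover C1M (u := u)); first by rewrite inE uU orbT.
  by rewrite !inE eqxx.
- apply: (@leq_trans #|\bigcup_(u in U) [set [set u; w] | w in C1]|).
    apply/subset_leq_card/subsetP=> e /XU[u uU [w wC ->]].
    by apply/bigcupP; exists u => //; apply/imsetP; exists w.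
  apply: leq_trans (card_bigcup_le _ _) _; apply: leq_trans ab.
  rewrite -cU -sum_nat_const; apply: leq_sum => u _.
  apply: leq_trans (leq_imset_card _ _) _; rewrite cC1 cU leq_add2r.
  by rewrite -mC leq_addr.
move=> Y Yb YB cY.
have cC' : clique (B :|: X) C1.
  move=> e eb eC; rewrite in_setU in_setD; case: (e \in B) => //=.
  by rewrite inE eb.
have := card_untouched cC' Yb YB; rewrite cC1 => cUn.
have /ex_subset_of_card[C2 C2C cC2] : #|C|.+1 <= #|untouched Y C1|.
  by apply: leq_trans cUn; lia.
apply: (IH C2).
- by rewrite cC2 -mC addnS.
- by rewrite subUset Mb.
- apply: leq_trans (leq_card_setU _ _) _; rewrite cC2 mulnS addnC.
  exact: leq_add.
- by apply/eqP; rewrite -finset.subset0 -(untouched_cover Y C1M) finset.setSI.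
apply: sub_clique cC'; first exact: subxx.
by apply: (subset_trans C2C); apply/subsetP=> u; rewrite inE => /andP[].
Qed.

Lemma breaker_wins_large_sum j :
  let m := 1 + j * a in
  a.+1 * (m + a.+1) <= b -> m + 2 * (a * m) + a.+1 <= n ->
  n.-1 <= \sum_(i < j.+1) b %/ (1 + i * a) -> wins Breaker n a b.
Proof.
move=> m ab mn nb; apply: (@breaker_wins_of_lead n a b (j + m)).
apply: (clique_lead (C := set0)) ab mn nb _ _ _ _ _; rewrite ?cards0 ?sub0set //.
  exact: finset.set0I.
move=> e; rewrite inE finset.subset0 => + /eqP e0; by rewrite e0 cards0.
Qed.

Lemma breaker_wins_first_move : 0 < n -> n.-1 <= b -> wins Breaker n a b.
Proof.
move=> n0 nb; apply: (@breaker_wins_of_lead n a b 0).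
pose v : 'I_n := Ordinal n0; exists (free_at set0 v); split.
- by rewrite /free_at finset.setD0; apply/subsetP=> e; rewrite inE => /andP[].
- by rewrite -setI_eq0 finset.setI0.
- exact: leq_trans (card_free_at _ _) nb.
by exists v => w wv; rewrite !inE cards2 (eq_sym v) wv eqxx.
Qed.

End BreakerStrategy.

(** * Maker: building an expander *)

Import Order.TTheory GRing.Theory Num.Theory.

(** * Two potentials: the danger of the vertices and the expected number of trapped sets *)

Section Potentials.
Local Open Scope ring_scope.
Variables (R : realType) (V : finType).

Definition count_from (ch : seq (V * V)) v := count (fun p => p.1 == v) ch.

Lemma sum_count_from ch : (\sum_v count_from ch v)%N = size ch.
Proof.
elim: ch => [|p ch IH] /=; first by rewrite big1.
rewrite big_split /= IH -add1n (bigD1 p.1) //= eqxx big1 // => v.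
by rewrite eq_sym => /negbTE->.
Qed.

Lemma count_in_set (A : {set V}) ch :
  count (fun p => p.1 \in A) ch = (\sum_(v in A) count_from ch v)%N.
Proof.
elim: ch => [|p ch IH] /=; first by rewrite big1.
rewrite big_split /= {}IH; congr addn; rewrite big_mkcond /=.
have [pA|pA] := boolP (p.1 \in A).
  rewrite (bigD1 p.1) //= pA eqxx big1 // => v; rewrite eq_sym => /negbTE->.
  by case: ifP.
rewrite big1 // => v _; case: ifP => // vA.
by apply/eqP; rewrite eqb0; apply: contraNneq pA => ->.
Qed.

Lemma cons_count_from p ch v :
  count_from (p :: ch) v = ((p.1 == v) + count_from ch v)%N.
Proof. by []. Qed.

Section Danger.
Variables (c : nat) (delta lambda : R).
Hypotheses (delta_gt0 : 0 < delta) (lambda_gt0 : 0 < lambda).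

Definition weight (cr : V -> R) ch v :=
  expR (lambda * cr v) * delta ^+ count_from ch v.

Definition danger (cr : V -> R) ch :=
  \sum_(v | (count_from ch v < c)%N) weight cr ch v.

Lemma weight_gt0 cr ch v : 0 < weight cr ch v.
Proof. by rewrite mulr_gt0 ?expR_gt0 ?exprn_gt0. Qed.

Lemma weight_le_danger cr ch v : (count_from ch v < c)%N ->
  weight cr ch v <= danger cr ch.
Proof.
move=> vc; rewrite /danger (bigD1 v) //= lerDl sumr_ge0 // => u _.
exact/ltW/weight_gt0.
Qed.

(** Let [v] maximise the weight [y] after the new credits. As [1 - x <= expR (- x)], the credits
    raise the sum by at most [y v * lambda * \sum_u t u], hence by at most [(1 - delta) * y v].
    Maker's edge at [v] takes off at least this much, and more if [v] now has [c] out-edges and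
    leaves the sum. *)
Lemma danger_step (cr t : V -> R) ch u0 :
  (forall v, 0 <= t v) -> lambda * \sum_v t v <= 1 - delta ->
  (count_from ch u0 < c)%N ->
  exists2 v, (count_from ch v < c)%N & forall w,
    danger (fun u => cr u + t u) ((v, w) :: ch) <= danger cr ch.
Proof.
move=> t0 ts u0c; pose y u := weight (fun u => cr u + t u) ch u.
have [v vc vmax] : exists2 v, (count_from ch v < c)%N &
    forall u, (count_from ch u < c)%N -> y u <= y v.
  case: (@arg_maxP _ R V u0 (fun u => (count_from ch u < c)%N) y u0c).
  by move=> v vc vm; exists v.
exists v => // w.
have yv0 : 0 < y v by exact: weight_gt0.
have split_ : danger (fun u => cr u + t u) ((v, w) :: ch) <=
   \sum_(u | (count_from ch u < c)%N) y u - (1 - delta) * y v.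
  rewrite (bigD1 v) //= addrAC -[X in X + _](_ : delta * y v = _); last by ring.
  rewrite /danger big_mkcond (bigD1 v) //=; apply: lerD.
    rewrite /= /weight cons_count_from /= eqxx.
    case: ifP => _; last by rewrite mulr_ge0 ?ltW.
    by rewrite /y /weight add1n exprS mulrCA.
  rewrite [X in _ <= X]big_mkcondl /= le_eqVlt; apply/orP; left; apply/eqP.
  apply: eq_bigr => u uv; rewrite /weight !cons_count_from /= eq_sym (negbTE uv).
  by [].
apply: (le_trans split_); rewrite lerBlDr /danger.
have yx u : (count_from ch u < c)%N ->
    y u <= weight cr ch u + y v * (lambda * t u).
  move=> uc; rewrite addrC -lerBlDl; apply: (@le_trans _ _ (y u - y u * (lambda * t u))).
    by rewrite lerB // ler_wpM2r ?vmax // mulr_ge0 // ltW.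
  have -> : weight cr ch u = y u * expR (- (lambda * t u)).
    by rewrite /y /weight mulrAC -expRD mulrDr addrK.
  rewrite -[X in X - _]mulr1 -mulrBr ler_wpM2l ?expR_ge1Dx //.
  exact/ltW/weight_gt0.
apply: (le_trans (ler_sum _ yx)); rewrite big_split /= lerD2l -!mulr_sumr mulrC.
rewrite ler_wpM2r ?(ltW yv0) //; apply: le_trans ts.
rewrite ler_wpM2l ?(ltW lambda_gt0) //.
rewrite [X in _ <= X](bigID (fun u => (count_from ch u < c)%N)) /=.
by rewrite lerDl sumr_ge0.
Qed.

End Danger.

Section Escape.
Variables (c k : nat) (Gam : R).
Hypothesis Gam_gt0 : 0 < Gam.

(** Bounds the probability that a uniform choice among at least [Gam] vertices hits a given set of
    [3 * #|A|] vertices. *)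
Definition trap_prob (A : {set V}) : R := (3 * #|A|)%:R / Gam.

(** Estimates the conditional probability that all [c * #|A|] out-edges of [A] end in [S]: for an
    edge already chosen, the factor [trap_prob A] is replaced by the indicator of its end lying in
    [S]. *)
Definition trap_weight (A S : {set V}) (ch : seq (V * V)) : R :=
  trap_prob A ^+ (c * #|A|) *
  \prod_(p <- ch | p.1 \in A) ((p.2 \in S)%:R / trap_prob A).

Definition trapping ch :=
  \sum_(A : {set V} | (0 < #|A| <= k)%N)
    \sum_(S : {set V} | #|S| == (3 * #|A|)%N) trap_weight A S ch.

Lemma trap_prob_gt0 (A : {set V}) : (0 < #|A|)%N -> 0 < trap_prob A.
Proof. by move=> A0; rewrite divr_gt0 // ltr0n muln_gt0. Qed.

Lemma trap_weight_ge0 (A S : {set V}) ch : (0 < #|A|)%N -> 0 <= trap_weight A S ch.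
Proof.
move=> A0; rewrite mulr_ge0 ?exprn_ge0 ?(ltW (trap_prob_gt0 A0)) //.
by apply: prodr_ge0 => p _; rewrite divr_ge0 ?ler0n ?(ltW (trap_prob_gt0 A0)).
Qed.

(** Averaging over [W]: the mean of the indicator of [S] is at most [#|S| / #|W|], hence at most
    [trap_prob A], so some [w] does not raise the sum. *)
Lemma trapping_step ch v (W : {set V}) : Gam <= #|W|%:R ->
  exists2 w, w \in W & trapping ((v, w) :: ch) <= trapping ch.
Proof.
move=> GW.
have W0 : (0 < #|W|)%N by rewrite -(ltr0n R); apply: lt_le_trans GW.
apply: contrapT => H.
have lt_ w : w \in W -> trapping ch < trapping ((v, w) :: ch).
  by move=> wW; rewrite ltNge; apply/negP=> le_; apply: H; exists w.
have : \sum_(w in W) trapping ch < \sum_(w in W) trapping ((v, w) :: ch).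
  have [w0 w0W] := card_gt0P W0.
  rewrite (bigD1 w0) // [X in _ < X](bigD1 w0) //=; apply: ltr_leD; first exact: lt_.
  by apply: ler_sum => w /andP[wW _]; exact/ltW/lt_.
apply/negP; rewrite -leNgt.
rewrite exchange_big [X in _ <= X]exchange_big /=; apply: ler_sum => A /andP[A0 _].
rewrite exchange_big [X in _ <= X]exchange_big /=; apply: ler_sum => S /eqP cS.
rewrite sumr_const -mulr_natr; have pA := trap_prob_gt0 A0.
have [vA|vA] := boolP (v \in A); last first.
  rewrite mulr_natr -sumr_const; apply: ler_sum => w _.
  by rewrite /trap_weight big_cons /= (negbTE vA).
under eq_bigr do rewrite /trap_weight big_cons /= vA mulrCA mulrC.
rewrite -mulr_sumr ler_wpM2l ?trap_weight_ge0 // -mulr_suml ler_pdivrMr //.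
apply: (@le_trans _ _ #|S|%:R).
  rewrite -natr_sum ler_nat; apply: (@leq_trans (\sum_(w : V) (w \in S))).
    by rewrite [X in (_ <= X)%N](bigID (mem W)) /= leq_addr.
  by rewrite -big_mkcond sum1_card.
rewrite cS /trap_prob mulrCA -[X in X <= _]mulr1.
by rewrite ler_wpM2l ?ler0n // ler_pdivlMr ?mul1r.
Qed.

(** A set [A] violating expansion has its neighbourhood inside some [S] of size [3 * #|A|]; the
    weight of this pair is exactly [1], and no weight is negative. *)
Lemma expander_of_trapping (g : rel V) ch : (3 * k <= #|V|)%N ->
  (forall p, p \in ch -> g p.1 p.2) ->
  (forall v, count_from ch v = c) -> trapping ch < 1 -> expander g k.
Proof.
move=> kV gch cch t1 A /andP[A0 Ak]; rewrite ltnNge; apply/negP=> sN.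
have [|S [NS _ cS]] := @ex_subset_card _ (A :|: neighbourhood g A) [set: V]
  (3 * #|A|) (subsetT _).
  by rewrite sN cardsT (leq_trans _ kV) // leq_mul2l.
move: t1; apply/negP; rewrite -leNgt.
have -> : 1 = trap_weight A S ch.
  rewrite /trap_weight; have pA := trap_prob_gt0 A0.
  rewrite big_seq_cond (eq_bigr (fun=> (trap_prob A)^-1)); last first.
    move=> p /andP[pch pinA]; have -> : p.2 \in S; last by rewrite mul1r.
    apply: (subsetP NS); rewrite !inE; apply/orP; right; apply/existsP; exists p.1.
    by rewrite pinA gch.
  rewrite -big_seq_cond big_const_seq iter_mulr_1 count_in_set.
  rewrite (eq_bigr (fun=> c)) // sum_nat_const mulnC exprVn mulfV //.
  by rewrite expf_neq0 // gt_eqF.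
rewrite /trapping (bigD1 A) ?A0 //= (bigD1 S) ?cS //= -addrA lerDl addr_ge0 //.
  by apply: sumr_ge0 => S' _; exact: trap_weight_ge0.
apply: sumr_ge0 => A' /andP[/andP[A'0 _] _]; apply: sumr_ge0 => S' _.
exact: trap_weight_ge0.
Qed.

End Escape.
End Potentials.

(** * Maker's two stages: [R1] rounds for an expander, then [R2] rounds of boosters *)

Section MakerStrategy.
Local Open Scope ring_scope.
Variables (R : realType) (n a b k c R1 R2 : nat) (delta rho Gam : R).
Local Notation edgeset := {set {set 'I_n}}.
Hypotheses (a_gt0 : (0 < a)%N) (b_gt0 : (0 < b)%N) (n_gt2 : (2 < n)%N).
Hypotheses (delta_gt0 : 0 < delta) (delta_lt1 : delta < 1) (Gam_gt0 : 0 < Gam)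
  (rho_gt0 : 0 < rho).

(** Chosen so that an instalment of total credit [b / a] meets the condition of [danger_step] with
    equality. *)
Let lambda : R := (1 - delta) * a%:R / b%:R.

(** The terms are the largest credit of a vertex whose weight is at most [n], the credit of
    Breaker's current move, the light degree carried without credit, the number of heavy vertices,
    the vertex itself, and the number of ends to choose from. *)
Hypothesis degree_bound :
  ln (n%:R / delta ^+ c) / lambda + b%:R + rho + (2 * (R1 * b))%:R / rho + 1 + Gam
    <= n%:R.
Hypothesis R1_large : (c * n <= a * R1)%N.
Hypothesis R2_large : (n.+1 <= a * R2)%N.
Hypothesis k_gt0 : (0 < k)%N.
Hypothesis k_small : (3 * k <= n)%N.
Hypothesis k_large : (2 * ((R1 + R2) * b) < k.+1 ^ 2)%N.
Hypothesis trapping_lt1 : trapping c k Gam ([::] : seq ('I_n * 'I_n)) < 1.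

Lemma lambda_gt0 : 0 < lambda.
Proof. by rewrite divr_gt0 ?mulr_gt0 ?subr_gt0 ?ltr0n. Qed.

Definition heavy (B : edgeset) : {set 'I_n} := [set v | rho <= (deg B v)%:R].

Definition light_deg (B : edgeset) v := #|[set u | erel B v u] :\: heavy B|.

(* Each new edge of [Y] is charged to its heavy endpoint when the other one is
   light, hence to at most one vertex. *)
Definition credit (B Y : edgeset) (v : 'I_n) : nat :=
  if v \in heavy (B :|: Y) then #|[set u | erel Y v u] :\: heavy (B :|: Y)| else 0.

Lemma deg_mono (B B' : edgeset) v : B \subset B' -> (deg B v <= deg B' v)%N.
Proof.
move=> BB; apply/subset_leq_card/subsetP=> u; rewrite !inE; exact: (subsetP BB).
Qed.

Lemma heavy_mono (B B' : edgeset) : B \subset B' -> heavy B \subset heavy B'.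
Proof.
move=> BB; apply/subsetP=> v; rewrite !inE => /le_trans; apply.
by rewrite ler_nat deg_mono.
Qed.

Lemma card_heavy (B : edgeset) : B \subset board n ->
  #|heavy B|%:R <= (2 * #|B|)%:R / rho.
Proof.
move=> Bb; rewrite ler_pdivlMr // -handshake // mulrC mulr_natr -sumr_const.
rewrite natr_sum [X in _ <= X](bigID (mem (heavy B))) /=.
rewrite -[X in X <= _]addr0 lerD ?sumr_ge0 //.
by apply: ler_sum => v; rewrite inE.
Qed.

(** The credits count ordered pairs of a heavy and a light vertex, and such a pair is determined by
    its edge. *)
Lemma sum_credit (B Y : edgeset) : (\sum_v credit B Y v <= #|Y|)%N.
Proof.
set H := heavy (B :|: Y).
pose P := [set p : 'I_n * 'I_n | [&& p.1 \in H, p.2 \notin H & erel Y p.1 p.2]].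
have -> : (\sum_v credit B Y v = #|P|)%N.
  rewrite -sum1_card (eq_bigl (fun p : 'I_n * 'I_n => (p.1 \in H) &&
    ((p.2 \notin H) && erel Y p.1 p.2))); last by move=> p; rewrite inE.
  rewrite -(pair_big_dep (mem H) (fun v u => (u \notin H) && erel Y v u)
    (fun _ _ => 1%N)) /=.
  rewrite [RHS]big_mkcond /=; apply: eq_bigr => v _; rewrite /credit -/H.
  by case: ifP => // _; rewrite sum1dep_card; apply: eq_card => u; rewrite !inE.
rewrite -(card_in_imset (f := fun p => [set p.1; p.2])).
  apply/subset_leq_card/subsetP=> e /imsetP[p]; rewrite inE => /and3P[_ _ pY] ->.
  exact: pY.
move=> [v u] [v' u']; rewrite !inE /= => /and3P[vH uH _] /and3P[v'H u'H _] E.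
have : v \in [set v'; u'] by rewrite -E !inE eqxx.
have : u \in [set v'; u'] by rewrite -E !inE eqxx orbT.
rewrite !inE => /orP[/eqP uv|/eqP->]; first by rewrite uv v'H in uH.
by case/orP=> [/eqP->//|/eqP vu]; rewrite vu (negbTE u'H) in vH.
Qed.

(** If [v] is heavy afterwards, its new light neighbours are paid for by the credit, and vertices
    turning heavy only lower the count. If [v] is not heavy, its whole degree is below [rho]. *)
Lemma light_deg_step (B Y : edgeset) (x : R) v :
  0 <= x -> (light_deg B v)%:R <= x + rho ->
  (light_deg (B :|: Y) v)%:R <= x + (credit B Y v)%:R + rho.
Proof.
move=> x0 lx; rewrite /credit; set H := heavy (B :|: Y).
have HH : heavy B \subset H by apply: heavy_mono; exact: subsetUl.
case: ifPn => vH.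
  apply: (@le_trans _ _ (light_deg B v + #|[set u | erel Y v u] :\: H|)%:R).
    rewrite ler_nat -cardsUI; apply: leq_trans (leq_addr _ _).
    apply/subset_leq_card/subsetP=> u; rewrite in_setD => /andP[uH uBY].
    have uHB := contra (subsetP HH u) uH; rewrite in_setU !in_setD uH uHB /=.
    by move: uBY; rewrite !in_set /erel in_setU.
  by rewrite natrD addrAC lerD2r.
rewrite addr0; apply: (@le_trans _ _ (deg (B :|: Y) v)%:R).
  by rewrite ler_nat subset_leq_card // subsetDl.
move: vH; rewrite inE -ltNge => /ltW/le_trans; apply.
by rewrite lerDr.
Qed.

(* The state kept through the first stage: [ch] lists the edges that Maker
   took for the sake of their first endpoint, [cr] the credits received. *)
Record stage1 (j : nat) (M B : edgeset) (ch : seq ('I_n * 'I_n))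
    (cr : 'I_n -> R) : Prop := Stage1 {
  stage1_M : M \subset board n;
  stage1_B : B \subset board n;
  stage1_ch : forall p, p \in ch -> erel M p.1 p.2;
  stage1_count : forall v, (count_from ch v <= c)%N;
  stage1_size : (minn (c * n) (a * j) <= size ch)%N;
  stage1_danger : danger c delta lambda cr ch <= n%:R;
  stage1_trapping : trapping c k Gam ch < 1;
  stage1_cr : forall v, 0 <= cr v;
  stage1_light : forall v, (light_deg B v)%:R <= cr v + rho;
  stage1_card : (#|B| <= j * b)%N }.

Lemma stage1_init : stage1 0 set0 set0 [::] (fun=> 0).
Proof.
split; rewrite ?sub0set ?cards0 ?muln0 ?minn0 //.
- rewrite /danger (eq_bigr (fun=> 1)) => [|v _].
    by rewrite sumr_const ler_nat (leq_trans (max_card _)) // card_ord.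
  by rewrite /weight mulr0 expR0 mul1r expr0.
- move=> v; rewrite add0r /light_deg.
  rewrite (_ : _ :\: _ = set0) ?cards0 ?ltW //.
  by apply/setP=> u; rewrite !inE /erel inE andbF.
Qed.

Lemma stage1_free_degree j M B ch cr (Y : edgeset) v : stage1 j M B ch cr ->
  (j < R1)%N -> Y \subset board n -> (#|Y| <= b)%N ->
  cr v <= ln (n%:R / delta ^+ c) / lambda ->
  Gam <= #|[set w | w != v & [set v; w] \notin B :|: Y]|%:R.
Proof.
move=> [_ Bb _ _ _ _ _ cr0 lB cB] jR Yb cY crv.
have BYb : B :|: Y \subset board n by rewrite subUset Bb.
have cBY : (#|B :|: Y| <= R1 * b)%N.
  apply: leq_trans (leq_card_setU _ _) _; apply: leq_trans (leq_add cB cY) _.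
  by rewrite addnC -mulSn leq_mul2r jR orbT.
pose W := [set w | w != v & [set v; w] \notin B :|: Y].
have dE : (n <= #|W| + deg (B :|: Y) v + 1)%N.
  rewrite -[X in (X <= _)%N]card_ord -cardsT -(cards1 v).
  apply: leq_trans (leq_add (leq_card_setU _ _) (leqnn _)).
  apply: leq_trans (leq_card_setU _ _); apply/subset_leq_card/subsetP=> w _.
  by rewrite !inE /erel !inE; case: (w =P v) => _; rewrite ?orbT //= orbF orNb.
have hd : ((deg (B :|: Y) v)%:R <= cr v + b%:R + rho + (2 * (R1 * b))%:R / rho).
  apply: (@le_trans _ _ (light_deg (B :|: Y) v + #|heavy (B :|: Y)|)%:R).
    rewrite ler_nat /deg -(cardsID (heavy (B :|: Y)) [set u | _]) [X in (X <= _)%N]addnC.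
    exact: leq_add (leqnn _) (subset_leq_card (subsetIr _ _)).
  rewrite natrD lerD //.
    apply: le_trans (light_deg_step Y (cr0 v) (lB v)) _.
    rewrite lerD2r lerD2l ler_nat (leq_trans _ cY) //.
    rewrite (leq_trans _ (sum_credit B Y)) //.
    by rewrite (bigD1 v) //= leq_addr.
  apply: le_trans (card_heavy BYb) _; rewrite ler_pM2r ?invr_gt0 // ler_nat.
  by rewrite leq_mul2l cBY.
rewrite -/W; have : (n%:R : R) <= (#|W| + deg (B :|: Y) v + 1)%:R.
  by rewrite ler_nat.
rewrite !natrD; move: degree_bound hd crv; lra.
Qed.

Lemma stage1_round j M B ch cr (Y : edgeset) : stage1 j M B ch cr -> (j < R1)%N ->
  Y \subset board n -> [disjoint Y & M] -> (#|Y| <= b)%N ->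
  exists (X : edgeset) ch' cr', [/\ X \subset board n,
    [disjoint X & B :|: Y], (#|X| <= a)%N &
    stage1 j.+1 (M :|: X) (B :|: Y) ch' cr'].
Proof.
move=> S jR Yb YM cY; have [Mb Bb chM cch sch dch tch cr0 lB cB] := S.
pose t v : R := (credit B Y v)%:R.
have t0 v : 0 <= t v by exact: ler0n.
have st : \sum_v t v <= b%:R.
  by rewrite -natr_sum ler_nat (leq_trans (sum_credit _ _)).
(* The credits after [i] of the [a] instalments; Maker's edges nevertheless avoid all of [Y] from
   the beginning. *)
pose cri i v := cr v + i%:R / a%:R * t v.
have loop i : exists (X : edgeset) ch',
  [/\ X \subset board n, [disjoint X & B :|: Y], (#|X| <= i)%N,
    (forall p, p \in ch' -> erel (M :|: X) p.1 p.2) &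
    [/\ (forall v, (count_from ch' v <= c)%N),
    (minn (c * n) (a * j + i) <= size ch')%N,
    danger c delta lambda (cri i) ch' <= n%:R &
    trapping c k Gam ch' < 1]].
  elim: i => [|i [X [ch' [Xb XB cX ch'M [cch' sch' dch' tch']]]]].
    exists set0, ch; rewrite sub0set cards0 setU0 addn0; split=> //.
      by rewrite -setI_eq0 finset.set0I.
    split=> //; rewrite /cri (_ : danger _ _ _ _ _ = danger c delta lambda cr ch) //.
    by congr danger; apply/funext=> v; rewrite !mul0r addr0.
  (* Once every vertex has [c] out-edges, Maker rests: [ch'] has length [c * n] and the danger is an
     empty sum. *)
  have [[u0 u0c]|done_] := pselect (exists u, (count_from ch' u < c)%N); last first.
    have cE v : count_from ch' v = c.
      apply/eqP; rewrite eqn_leq cch' leqNgt; apply/negP=> vc.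
      by apply: done_; exists v.
    exists X, ch'; split=> //; first exact: leqW.
    split=> //.
      rewrite -(sum_count_from ch') (eq_bigr (fun=> c)) // sum_nat_const card_ord.
      by rewrite mulnC geq_minl.
    by rewrite /danger big1 ?ler0n // => v; rewrite cE ltnn.
  have [||v vc vd] := @danger_step R _ c delta lambda delta_gt0 lambda_gt0
    (cri i) (fun v => t v / a%:R) ch' u0 _ _ u0c.
  - by move=> v; rewrite divr_ge0 ?ler0n.
  - rewrite -mulr_suml mulrA ler_pdivrMr ?ltr0n //.
    rewrite /lambda mulrAC ler_pdivrMr ?ltr0n // ler_wpM2l // mulr_ge0 ?ler0n //.
    by rewrite subr_ge0 ltW.
  (* The weight of [v] is at most the danger, hence at most [n], and fewer than [c] factors [delta]
     enter it. *)
  have crv : cr v <= ln (n%:R / delta ^+ c) / lambda.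
    rewrite ler_pdivlMr ?lambda_gt0 // mulrC -ler_expR lnK; last first.
      by rewrite posrE divr_gt0 ?exprn_gt0 // ltr0n (ltnW (ltnW n_gt2)).
    rewrite ler_pdivlMr ?exprn_gt0 //.
    have wd := @weight_le_danger R _ c delta lambda delta_gt0 (cri i) ch' v vc.
    apply: le_trans dch'; apply: le_trans wd.
    rewrite /weight ler_pM ?expR_ge0 ?exprn_ge0 ?(ltW delta_gt0) //.
      rewrite ler_expR ler_wpM2l ?(ltW lambda_gt0) // /cri lerDl mulr_ge0 //.
      by rewrite divr_ge0 ?ler0n.
    by rewrite ler_wiXn2l ?(ltW delta_gt0) ?(ltW delta_lt1).
  (* Edges that Maker already owns are allowed here: the relaxed game permits claiming them
     again. *)
  have GW := stage1_free_degree S jR Yb cY crv.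
  have [w] := @trapping_step R _ c k Gam Gam_gt0 ch' v _ GW.
  rewrite inE => /andP[wv wB] tw.
  exists (X :|: [set [set v; w]]), ((v, w) :: ch'); split.
  - by rewrite subUset Xb sub1set inE cards2 (eq_sym v) wv.
  - by rewrite disjointsU XB disjoints_subset sub1set inE.
  - by apply: leq_trans (leq_card_setU _ _) _; rewrite cards1 addn1.
  - move=> p; rewrite inE => /orP[/eqP->|/ch'M]; rewrite /erel !inE ?eqxx ?orbT //.
    by case/orP=> ->; rewrite ?orbT.
  split.
  - move=> u; rewrite cons_count_from /=; case: eqP => [<-|_]; last exact: cch'.
    by rewrite add1n.
  - rewrite /= addnS geq_min ltnS; move: sch'; rewrite geq_min.
    by case/orP=> h; apply/orP; [left; exact: leqW|right].
  - rewrite (_ : cri i.+1 = fun u => cri i u + t u / a%:R).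
      exact: le_trans (vd w) dch'.
    apply/funext=> u; rewrite /cri -natr1 mulrDl mul1r mulrDl addrA.
    by rewrite [_^-1 * _]mulrC.
  exact: le_lt_trans tw tch'.
have [X [ch' [Xb XB cX ch'M [cch' sch' dch' tch']]]] := loop a.
exists X, ch', (cri a); split=> //; split=> //.
- by rewrite subUset Mb.
- by rewrite subUset Bb.
- by rewrite mulnS addnC.
- by move=> v; rewrite /cri addr_ge0 // mulr_ge0 // divr_ge0 ?ler0n.
- move=> v; rewrite /cri divff ?mul1r ?pnatr_eq0 -?lt0n //.
  exact: light_deg_step.
apply: leq_trans (leq_card_setU _ _) _; rewrite mulSn addnC; exact: leq_add.
Qed.

Lemma expander_mono (M M' : edgeset) l : M \subset M' ->
  expander (erel M) l -> expander (erel M') l.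
Proof.
move=> MM eM A cA; apply: leq_trans (eM A cA) _.
apply/subset_leq_card/finset.setUS/subsetP=> w; rewrite !inE.
move=> /existsP[v /andP[vA vw]]; apply/existsP; exists v; rewrite vA.
exact: (subsetP MM).
Qed.

(** Each edge of Maker is a booster, so without a Hamilton cycle the path guaranteed by the last
    alternative would end up with more than [n] vertices. *)
Lemma stage2_respond d j (M B : edgeset) :
  M \subset board n -> B \subset board n -> expander (erel M) k ->
  (2 * (#|B| + d * b) < k.+1 ^ 2)%N -> (n.+1 <= j + a * d)%N ->
  (contains_hamilton_cycle M \/ exists2 t, gpath (erel M) t & (j <= size t)%N) ->
  respond (@contains_hamilton_cycle n) a b d M B.
Proof.
elim: d j M B => [|d IH] j M B Mb Bb eM Bk nj Hj /=.
  case: Hj => // -[t /andP[ut _] jt]; have := max_card (mem t).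
  rewrite card_ord (card_uniqP ut) leqNgt (leq_trans _ jt) //.
  by rewrite muln0 addn0 in nj.
move=> Y Yb YM cY.
have BYb : B :|: Y \subset board n by rewrite subUset Bb.
have cBY : (#|B :|: Y| <= #|B| + b)%N.
  by apply: leq_trans (leq_card_setU _ _) _; rewrite leq_add2l.
have loop i : exists X : edgeset, [/\ X \subset board n,
    [disjoint X & B :|: Y], (#|X| <= i)%N & contains_hamilton_cycle (M :|: X) \/
    exists2 t, gpath (erel (M :|: X)) t & (j + i <= size t)%N].
  elim: i => [|i [X [Xb XB cX HX]]].
    exists set0; rewrite sub0set cards0 setU0 addn0; split=> //.
    by rewrite -setI_eq0 finset.set0I.
  have [||||||e [eb eB ce He]] := @boost_step n (M :|: X) (B :|: Y) k (j + i).
  - exact: BYb.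
  - by apply: expander_mono eM; exact: subsetUl.
  - exact: k_gt0.
  - exact: n_gt2.
  - by apply: leq_ltn_trans Bk; rewrite leq_mul2l (leq_trans cBY) // leq_add2l leq_pmull.
  - exact: HX.
  exists (X :|: e); rewrite finset.setUA addnS; split=> //.
  - by rewrite subUset Xb.
  - by rewrite disjointsU XB.
  by apply: leq_trans (leq_card_setU _ _) _; rewrite -addn1 leq_add.
have [X [Xb XB cX HX]] := loop a.
exists X; split=> //; apply: (IH (j + a)%N) => //.
- by rewrite subUset Mb.
- by apply: expander_mono eM; exact: subsetUl.
- by apply: leq_ltn_trans Bk; rewrite leq_mul2l mulSn addnA leq_add2r cBY orbT.
- by rewrite mulnS addnA in nj.
Qed.

Lemma stage1_respond d j M B ch cr : (j + d = R1)%N -> stage1 j M B ch cr ->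
  respond (@contains_hamilton_cycle n) a b (d + R2) M B.
Proof.
elim: d j M B ch cr => [|d IH] j M B ch cr jd S.
  rewrite addn0 in jd; have [Mb Bb chM cch sch dch tch cr0 lB cB] := S.
  apply: (stage2_respond (j := 0)) => //.
  - apply: (@expander_of_trapping R _ c k Gam Gam_gt0 _ ch _ chM _ tch).
      by rewrite card_ord.
    (* The list has length at least [c * n] and no count exceeds [c], so every count equals [c]. *)
    have cE : (\sum_(v : 'I_n) (c - count_from ch v) = 0)%N.
      rewrite sumnB; last by move=> v _; exact: cch.
      rewrite sum_count_from sum_nat_const card_ord; apply/eqP; rewrite subn_eq0.
      by move: sch; rewrite jd (minn_idPl R1_large) mulnC.
    move=> v; apply/eqP; rewrite eqn_leq cch -subn_eq0 -leqn0 -cE.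
    by rewrite (bigD1 v) //= leq_addr.
  - apply: leq_ltn_trans k_large; rewrite add0n leq_mul2l mulnDl leq_add2r.
    by rewrite -jd cB orbT.
  by right; exists [::].
move=> Y Yb YM cY.
have jR : (j < R1)%N by rewrite -jd addnS ltnS leq_addr.
have [X [ch' [cr' [Xb XB cX S']]]] := stage1_round S jR Yb YM cY.
by exists X; split=> //; apply: IH S'; rewrite -jd addnS.
Qed.

Lemma maker_wins_of_bounds : wins Maker n a b.
Proof.
apply: (@maker_wins_of_respond n a b (R1 + R2)).
exact: (stage1_respond _ stage1_init).
Qed.

End MakerStrategy.

(** * First-moment bound on trapped sets *)

Section TrappingBound.
Local Open Scope ring_scope.
Variable R : realType.

Lemma ffact_le_exp n i : (n ^_ i <= n ^ i)%N.
Proof.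
elim: i n => [//|i IH] n; rewrite ffactnS expnS leq_mul //.
apply: leq_trans (IH _) _; case: i {IH} => // i.
by rewrite leq_exp2r // leq_pred.
Qed.

(** The bound [(e n / i) ^ i] on the binomial, cleared of denominators; it rests on
    [i ^ i / i! <= e ^ i], a single term of the exponential series. *)
Lemma bin_le_exp n i : (0 < i)%N ->
  'C(n, i)%:R * i%:R ^+ i <= (expR 1 * n%:R) ^+ i :> R.
Proof.
move=> i0; have f0 : 0 < i`!%:R :> R by rewrite ltr0n fact_gt0.
have ie : i%:R ^+ i <= i`!%:R * expR 1 ^+ i :> R.
  rewrite mulrC -ler_pdivrMr // -expRM_natl mulr1.
  have := @expR_ge1Dxn R i%:R i.-1 (ler0n _ _); rewrite prednK //.
  by apply: le_trans; rewrite lerDr.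
apply: (@le_trans _ _ ('C(n, i)%:R * (i`!%:R * expR 1 ^+ i))).
  by rewrite ler_wpM2l // ler0n.
rewrite mulrA -natrM bin_ffact exprMn mulrC ler_wpM2l ?exprn_ge0 ?expR_ge0 //.
by rewrite -natrX ler_nat ffact_le_exp.
Qed.

Lemma sum_quarter_powers k : \sum_(i < k) (4^-1 : R) ^+ i.+1 <= (1 - 4^-1 ^+ k) / 3.
Proof.
elim: k => [|k IH]; first by rewrite big_ord0 expr0 subrr mul0r.
rewrite big_ord_recr /= (le_trans (lerD IH (lexx _))) //.
by rewrite !exprS; move: (4^-1 ^+ k) => x; lra.
Qed.

(** The pairs with [#|A| = i] contribute at most [(9 * e ^ 4 * n ^ 4 * i / Gam ^ 5) ^ i], which the
    hypothesis bounds by [4 ^ (- i)]. Five out-edges yield [i ^ (5 i)] against [i ^ (4 i)] from the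
    two binomials, so a small ratio of [k] to [n] suffices when [Gam] is linear in [n]. *)
Lemma trapping_nil_lt1 n k (Gam : R) : 0 < Gam ->
  36 * expR 1 ^+ 4 * k%:R * n%:R ^+ 4 <= Gam ^+ 5 ->
  trapping 5 k Gam ([::] : seq ('I_n * 'I_n)) < 1.
Proof.
move=> G0 kG.
pose F i : R := 'C(n, 3 * i)%:R * ((3 * i)%:R / Gam) ^+ (5 * i).
have cd m : #|[pred S : {set 'I_n} | #|S| == m]| = 'C(n, m).
  by rewrite -cardsE card_draws card_ord.
have -> : trapping 5 k Gam ([::] : seq ('I_n * 'I_n)) =
    \sum_(A : {set 'I_n} | (0 < #|A| <= k)%N) F #|A|.
  apply: eq_bigr => A _; rewrite (eq_bigr (fun=> trap_prob Gam A ^+ (5 * #|A|))).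
    by rewrite sumr_const /F mulr_natl cd.
  by move=> S _; rewrite /trap_weight big_nil mulr1.
rewrite (partition_big (fun A : {set 'I_n} => inord #|A| : 'I_k.+1)
  (fun i : 'I_k.+1 => (0 < i)%N)) /=; last first.
  by move=> A /andP[A0 Ak]; rewrite inordK.
apply: (@le_lt_trans _ _ (\sum_(i < k.+1 | (0 < i)%N) 4^-1 ^+ i)); last first.
  rewrite big_mkcond big_ord_recl /= add0r; apply: le_lt_trans (sum_quarter_powers k) _.
  have : 0 < 4^-1 ^+ k :> R by rewrite exprn_gt0 // invr_gt0 ltr0n.
  by move: (4^-1 ^+ k) => x; lra.
apply: ler_sum => i i0.
apply: (@le_trans _ _ ('C(n, i)%:R * F i)).
  rewrite (eq_bigr (fun=> F i)) => [|A /andP[/andP[A0 Ak] /eqP <-]]; last first.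
    by rewrite inordK.
  rewrite sumr_const -[leLHS]mulr_natl ler_wpM2r //.
    by rewrite mulr_ge0 // exprn_ge0 // divr_ge0 // ltW.
  rewrite ler_nat -cd subset_leq_card //.
  apply/subsetP=> A; rewrite !inE => /andP[/andP[A0 Ak] /eqP <-].
  by rewrite inordK.
pose e := expR (1 : R).
have e0 : 0 <= e by exact: expR_ge0.
have b1 := @bin_le_exp n i i0.
have b2 : 'C(n, 3 * i)%:R * (3 * i)%:R ^+ (3 * i) <= (e * n%:R) ^+ (3 * i).
  by apply: bin_le_exp; rewrite muln_gt0.
have G5 : 0 < Gam ^+ (5 * i) by rewrite exprn_gt0.
rewrite /F expr_div_n mulrA mulrA ler_pdivrMr //.
have -> : (3 * i)%:R ^+ (5 * i) =
    (3 * i)%:R ^+ (3 * i) * (9%:R ^+ i * (i%:R ^+ i * i%:R ^+ i)) :> R.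
  have -> : (5 * i = 3 * i + (i + i))%N by lia.
  rewrite !exprD !natrM; congr (_ * _); rewrite -!exprMn; congr (_ ^+ _).
  by ring.
apply: (@le_trans _ _ ((e * n%:R) ^+ i * (e * n%:R) ^+ (3 * i) *
    (9%:R ^+ i * i%:R ^+ i))).
  have -> : forall x y z u v w : R,
      x * y * (z * (u * (v * w))) = (x * v) * (y * z) * (u * w).
    by move=> *; ring.
  apply: ler_wpM2r; first by rewrite mulr_ge0 ?exprn_ge0 ?ler0n.
  by apply: ler_pM => //; rewrite mulr_ge0 ?exprn_ge0 ?ler0n.
have -> : (e * n%:R) ^+ i * (e * n%:R) ^+ (3 * i) * (9%:R ^+ i * i%:R ^+ i) =
    ((e * n%:R) ^+ 4 * (9%:R * i%:R)) ^+ i.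
  move: (e * n%:R) => x; rewrite -exprD [RHS]exprMn [(9 * _) ^+ _]exprMn -exprM.
  by rewrite -[(i + 3 * i)%N]/(4 * i)%N.
rewrite exprM -exprMn; apply: lerXn2r; rewrite ?nnegrE.
- by rewrite !mulr_ge0 ?exprn_ge0 ?mulr_ge0 ?ler0n.
- by rewrite mulr_ge0 ?invr_ge0 ?ler0n // exprn_ge0 // ltW.
rewrite [leRHS]mulrC ler_pdivlMr //; apply: le_trans kG.
have -> : (e * n%:R) ^+ 4 * (9%:R * i%:R) * 4 = 36 * e ^+ 4 * i%:R * n%:R ^+ 4.
  by ring.
rewrite ler_wpM2r ?exprn_ge0 ?ler0n // ler_wpM2l ?mulr_ge0 ?exprn_ge0 //.
by rewrite ler_nat -ltnS.
Qed.

End TrappingBound.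

(** * Asymptotics *)

Section Asymptotics.
Local Open Scope ring_scope.
Variable R : realType.

Lemma ln_large (L : R) : exists n0 : nat, forall n, (n0 <= n)%N -> L <= ln n%:R.
Proof.
exists (Num.truncn (expR L)).+1 => n ln0.
have n0 : expR L <= n%:R.
  by apply: le_trans (ltW (truncnS_gt _)) _; rewrite ler_nat.
rewrite -[leLHS]expRK ler_ln ?posrE ?expR_gt0 //.
exact: lt_le_trans (expR_gt0 _) n0.
Qed.

Lemma quartic_le_exp (x : R) : 0 <= x -> x ^+ 4 / 24 <= expR x.
Proof.
move=> x0; have := expR_ge1Dxn 3 x0; apply: le_trans.
by rewrite (_ : 4`! = 24%N) // lerDr.
Qed.

(** Here [L] stands for [ln n], [x] for [b / a] and [r] for [- ln (delta ^+ 5)] with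
    [delta = eps / 4]. Of the margin [eps * n] left by [x * L + b], the division by [1 - delta], the
    term [rho] and the term [Gam] use a quarter each; the remaining errors are multiples of
    [q = n / L] and fit into the last quarter. *)
Lemma degree_estimate (eps n L x b r R1b : R) :
  0 < eps -> eps < 1 -> 0 < n -> 1 <= L -> L <= n -> 0 <= x -> 0 <= r -> 0 <= b ->
  x * L + b <= (1 - eps) * n -> x * L <= n ->
  R1b * L <= 9 * n ^+ 2 ->
  4 * (2 * r + 72 / eps + 1) / eps <= L ->
  (L + r) * x / (1 - eps / 4) + b + eps / 4 * n + (2 * R1b) / (eps / 4 * n)
    + 1 + eps / 4 * n <= n.
Proof.
move=> e0 e1 n0 L1 Ln x0 r0 b0 h hx hR hL.
have L0 : 0 < L by lra.
pose q := n / L.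
have qL : q * L = n by rewrite /q divfK ?gt_eqF.
have q1 : 1 <= q by rewrite ler_pdivlMr // mul1r.
have xq : x <= q by rewrite ler_pdivlMr.
have R1q : R1b <= 9 * n * q.
  by rewrite /q mulrA ler_pdivlMr // -mulrA -expr2.
have t1 : (2 * R1b) / (eps / 4 * n) <= 72 / eps * q.
  rewrite ler_pdivrMr; last by rewrite mulr_gt0 //; lra.
  have -> : 72 / eps * q * (eps / 4 * n) = 18 * n * q by field; rewrite gt_eqF.
  lra.
have d0 : 0 < 1 - eps / 4 by lra.
have rx : r * x <= r * q by rewrite ler_wpM2l.
have rq0 : 0 <= r * q by rewrite mulr_ge0 //; lra.
have rqe : r * q * eps <= r * q by rewrite -[leRHS]mulr1 ler_wpM2l // ltW.
have be0 : 0 <= b * eps by rewrite mulr_ge0 // ltW.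
have en0 : 0 <= eps * eps * n by rewrite !mulr_ge0 // ltW.
have t2 : (L + r) * x / (1 - eps / 4) <= (1 - 3 / 4 * eps) * n + 2 * (r * q) - b.
  by rewrite ler_pdivrMr //; lra.
have t3 : 2 * (r * q) + 72 / eps * q + q <= eps / 4 * n.
  have -> : 2 * (r * q) + 72 / eps * q + q = (2 * r + 72 / eps + 1) * q by ring.
  have -> : eps / 4 * n = (eps / 4 * L) * q by rewrite -qL; ring.
  rewrite ler_wpM2r //; first by lra.
  by move: hL; rewrite ler_pdivrMr //; lra.
clear - q1 t1 t2 t3.
move: ((L + r) * x / _) (_ / (eps / 4 * n)) (72 / eps * q) (r * q) t1 t2 t3.
by move=> *; lra.
Qed.

Lemma ltn_mul_divS m a : (0 < a -> m < a * (m %/ a + 1))%N.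
Proof. by move=> a0; rewrite addn1 mulnC ltn_ceil. Qed.

Lemma maker_wins_asymptotically (eps : R) : 0 < eps ->
  exists n0 : nat, forall n, (n0 <= n)%N -> forall a b : nat,
  (0 < a)%N -> (0 < b)%N ->
  b%:R <= (1 - eps) * (a%:R * n%:R / (a%:R + ln n%:R)) -> wins Maker n a b.
Proof.
move=> e0.
pose r := - ln ((eps / 4) ^+ 5).
(* With [k = n %/ D], the first summand serves [trapping_nil_lt1] for [Gam = eps / 4 * n], and the
   [3] ensures [3 * k <= n]. *)
pose D := (Num.truncn (36 * expR 1 ^+ 4 * (4 / eps) ^+ 5) + 3)%N.
(* The middle term is required by [degree_estimate]; the last makes twice Breaker's at most
   [9 * n ^ 2 / ln n] edges fewer than [k.+1 ^ 2]. *)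
pose L0 := 1 + 4 * (2 * r + 72 / eps + 1) / eps + 18 * D%:R ^+ 2.
have [n1 Hn1] := ln_large L0; exists (maxn n1 (maxn 3 D)) => n.
rewrite !geq_max => /and3P[nn1 n3 nD] a b a0 b0 hb.
have {Hn1} := Hn1 n nn1; set L := ln n%:R => hL.
have nR : 0 < n%:R :> R by rewrite ltr0n; lia.
have aR : 0 < a%:R :> R by rewrite ltr0n.
have bR : 0 < b%:R :> R by rewrite ltr0n.
have n1R : 1 <= n%:R :> R by rewrite ler1n; lia.
have e1 : eps < 1.
  rewrite ltNge; apply/negP => e1; have := lt_le_trans bR hb.
  apply/negP; rewrite -leNgt mulr_le0_ge0 ?subr_le0 //.
  by rewrite divr_ge0 ?mulr_ge0 ?addr_ge0 ?ler0n // ln_ge0.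
have r0 : 0 <= r.
  by rewrite oppr_ge0 ln_le0 // exprn_ile1 //; lra.
have D2 : 0 <= D%:R ^+ 2 :> R by rewrite exprn_ge0.
have P0 : 0 <= 4 * (2 * r + 72 / eps + 1) / eps.
  rewrite divr_ge0 ?(ltW e0) // mulr_ge0 // !addr_ge0 ?mulr_ge0 //.
  by rewrite invr_ge0 ltW.
have L1 : 1 <= L by move: hL; rewrite /L0; lra.
have Ln : L <= n%:R by rewrite ltW // ln_sublinear.
pose x : R := b%:R / a%:R.
have xa : x * a%:R = b%:R by rewrite divfK // gt_eqF.
have hx : x * L + b%:R <= (1 - eps) * n%:R.
  have aL : 0 < a%:R + L by lra.
  move: hb; rewrite -/L mulrA ler_pdivlMr // -xa => hb.
  by rewrite -(ler_pM2r aR); move: hb; lra.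
have x0 : 0 < x by rewrite divr_gt0.
have en : 0 < eps * n%:R by rewrite mulr_gt0.
have xL0 : 0 < x * L by rewrite mulr_gt0 //; lra.
have xL : x * L <= n%:R by lra.
have bn : b%:R <= n%:R :> R by lra.
(* Rounds enough for [5 * n] out-edges and for [n.+1] boosters, [a] per round; the [+ 1] compensates
   for rounding down. *)
pose R1 := (5 * n %/ a + 1)%N; pose R2 := (n.+1 %/ a + 1)%N.
have R12 : ((R1 + R2) * b)%:R * L <= 9 * n%:R ^+ 2.
  have R1a : (R1 * a)%:R <= (5 * n + a)%:R :> R.
    by rewrite ler_nat /R1 mulnDl mul1n leq_add2r leq_trunc_div.
  have R2a : (R2 * a)%:R <= (n.+1 + a)%:R :> R.
    by rewrite ler_nat /R2 mulnDl mul1n leq_add2r leq_trunc_div.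
  have bL : b%:R * L <= n%:R ^+ 2.
    by rewrite expr2 ler_pM ?ler0n //; lra.
  have -> : ((R1 + R2) * b)%:R * L = ((R1 * a)%:R + (R2 * a)%:R) * (x * L) :> R.
    by rewrite natrM -xa natrD !natrM; ring.
  apply: (@le_trans _ _ (((5 * n + a)%:R + (n.+1 + a)%:R) * (x * L))).
    by rewrite ler_wpM2r ?(ltW xL0) // lerD.
  rewrite [(5 * n + a)%:R]natrD natrM [(n.+1 + a)%:R]natrD -[n.+1%:R]natr1.
  have -> : (5%:R * n%:R + a%:R + (n%:R + 1 + a%:R)) * (x * L) =
     (6 * n%:R + 1) * (x * L) + 2 * (b%:R * L) :> R by rewrite -xa; ring.
  have : (6 * n%:R + 1) * (x * L) <= 7 * n%:R * n%:R.
    by apply: ler_pM => //; lra.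
  by lra.
pose k := (n %/ D)%N.
have D0 : (0 < D)%N by rewrite /D addn3.
apply: (@maker_wins_of_bounds R n a b k 5 R1 R2 (eps / 4)
  (eps / 4 * n%:R) (eps / 4 * n%:R)) => //.
- by lra.
- by lra.
- by rewrite mulr_gt0 //; lra.
- by rewrite mulr_gt0 //; lra.
- have := @degree_estimate eps n%:R L x b%:R r (R1 * b)%:R e0 e1 nR L1 Ln
    (ltW x0) r0 (ltW bR) hx xL.
  have -> : ln (n%:R / (eps / 4) ^+ 5) / ((1 - eps / 4) * a%:R / b%:R) =
      (L + r) * x / (1 - eps / 4).
    rewrite ln_div ?posrE ?exprn_gt0 ?divr_gt0 // -/L -/r /x; field.
    by rewrite ?gt_eqF //; lra.
  rewrite [in (2 * _)%:R]natrM; apply.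
    apply: le_trans R12; rewrite ler_wpM2r ?(le_trans ler01) // ler_nat.
    by rewrite leq_mul2r leq_addr orbT.
  by move: hL; rewrite /L0; lra.
- by rewrite ltnW // /R1 ltn_mul_divS.
- by rewrite ltnW // /R2 ltn_mul_divS.
- by rewrite divn_gt0.
- apply: leq_trans (leq_trunc_div n D); rewrite mulnC leq_mul2l /D.
  by rewrite leq_addl orbT.
- have nkD : n%:R < k.+1%:R * D%:R :> R by rewrite -natrM ltr_nat ltn_ceil.
  have nkD2 : n%:R ^+ 2 <= (k.+1%:R * D%:R) ^+ 2 :> R.
    by rewrite lerXn2r ?nnegrE ?mulr_ge0 ?ler0n // ltW.
  have Lpos : 0 < L by lra.
  rewrite -(ltr_nat R) natrM natrX -(ltr_pM2r Lpos).
  have k2 : 0 < k.+1%:R ^+ 2 :> R by rewrite exprn_gt0.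
  apply: (@lt_le_trans _ _ ((18 * D%:R ^+ 2 + 1) * k.+1%:R ^+ 2)); last first.
    by rewrite [leRHS]mulrC ler_wpM2r ?(ltW k2) //; move: hL; rewrite /L0; lra.
  by move: nkD2; rewrite exprMn; lra.
apply: trapping_nil_lt1; first by rewrite mulr_gt0 //; lra.
pose C : R := 36 * expR 1 ^+ 4 * (4 / eps) ^+ 5.
have CD : C <= D%:R.
  by apply: le_trans (ltW (truncnS_gt _)) _; rewrite ler_nat /D -/C addn3 ltnS leqW.
have kD : k%:R * D%:R <= n%:R :> R by rewrite -natrM ler_nat leq_trunc_div.
have -> : 36 * expR 1 ^+ 4 * k%:R * n%:R ^+ 4 =
    (eps / 4) ^+ 5 * (C * k%:R) * n%:R ^+ 4.
  rewrite /C; field; by rewrite gt_eqF.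
have -> : (eps / 4 * n%:R) ^+ 5 = (eps / 4) ^+ 5 * n%:R * n%:R ^+ 4 by ring.
rewrite ler_wpM2r ?exprn_ge0 //.
rewrite ler_wpM2l ?exprn_ge0 //; first by lra.
by apply: le_trans kD; rewrite [leRHS]mulrC ler_wpM2r.
Qed.

End Asymptotics.

(** * Breaker's side of the threshold *)

Section BreakerAsymptotics.
Local Open Scope ring_scope.
Variable R : realType.

Lemma ln_step_le (a i : nat) :
  ln (1 + i.+1%:R * a%:R) - ln (1 + i%:R * a%:R) <= a%:R / (1 + i%:R * a%:R) :> R.
Proof.
have p m : 0 < 1 + m%:R * a%:R :> R by rewrite ltr_wpDr // mulr_ge0 ?ler0n.
rewrite -ln_div ?posrE //.
have -> : (1 + i.+1%:R * a%:R) / (1 + i%:R * a%:R) = 1 + a%:R / (1 + i%:R * a%:R) :> R.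
  by rewrite -natr1; field; rewrite gt_eqF.
by apply: le_ln1Dx; apply: lt_le_trans (ltrN10 R) _; rewrite divr_ge0 ?ler0n // ltW.
Qed.

(** The harmonic-type sum is compared with a logarithm through [ln_step_le]. The first term is
    exactly [b], and each of the other [j] terms loses at most [1] to rounding. *)
Lemma sum_div_ge (a b j : nat) : (0 < a)%N ->
  b%:R + b%:R / a%:R * (ln (1 + j.+1%:R * a%:R) - ln (1 + a%:R)) - j%:R
   <= (\sum_(i < j.+1) b %/ (1 + i * a))%:R :> R.
Proof.
move=> a0; have aR : 0 < a%:R :> R by rewrite ltr0n.
elim: j => [|j IH].
  by rewrite big_ord1 mul0n addn0 divn1 mul1r subrr mulr0 addr0 subr0.
rewrite big_ord_recr /= natrD.
have p : 0 < 1 + j.+1%:R * a%:R :> R by rewrite ltr_wpDr // mulr_ge0 ?ler0n.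
have f : b%:R / (1 + j.+1%:R * a%:R) - 1 <= (b %/ (1 + j.+1 * a))%:R :> R.
  rewrite lerBlDr ler_pdivrMr //.
  have -> : 1 + j.+1%:R * a%:R = (1 + j.+1 * a)%:R :> R by rewrite natrD natrM.
  by rewrite natr1 -natrM ler_nat ltnW // ltn_ceil // add1n.
apply: le_trans (lerD IH f); rewrite -[j.+1%:R in X in X <= _]natr1.
have := ln_step_le a j.+1.
have b0 : 0 <= b%:R / a%:R :> R by rewrite divr_ge0 ?ler0n.
move=> /(ler_wpM2l b0).
have -> : b%:R / a%:R * (a%:R / (1 + j.+1%:R * a%:R)) =
    b%:R / (1 + j.+1%:R * a%:R) :> R.
  by rewrite mulrA divfK // gt_eqF.
by move: (ln (1 + j.+2%:R * a%:R)) (ln (1 + j.+1%:R * a%:R)) => u v; lra.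
Qed.

(** As [y] is at least [expR L / L ^+ 2] and [A] at most [L / eps], their quotient falls short of
    [expR L] by a factor of order [L ^+ 3], which [expR (eta * L)] absorbs. *)
Lemma ln_gap_estimate (eps eta L A y : R) : 0 < eps -> 0 < eta -> 0 < L ->
  1 <= A -> A * eps <= L -> expR L <= y * L ^+ 2 -> 48 / (eps * eta ^+ 4) <= L ->
  (1 - eta) * L <= ln (1 + y) - ln (1 + A).
Proof.
move=> e0 eta0 L0 A1 AeL Ly Leta.
have L2 : 0 < L ^+ 2 by rewrite exprn_gt0.
have p1 : 0 < 1 + A by lra.
have y0 : 0 < y by rewrite -(pmulr_lgt0 _ L2); exact: lt_le_trans (expR_gt0 _) Ly.
have p2 : 0 < 1 + y by lra.
rewrite -ln_div ?posrE // -[leLHS]expRK ler_ln ?posrE ?expR_gt0 ?divr_gt0 //.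
rewrite ler_pdivlMr // mulrBl mul1r expRB mulrAC ler_pdivrMr ?expR_gt0 //.
have h3 : 2 * L ^+ 3 <= eps * expR (eta * L).
  apply: (@le_trans _ _ (eps * ((eta * L) ^+ 4 / 24))); last first.
    by rewrite ler_wpM2l ?(ltW e0) // quartic_le_exp // mulr_ge0 // ltW.
  have t1 : 48 <= L * (eps * eta ^+ 4).
    by rewrite -ler_pdivrMr // mulr_gt0 // exprn_gt0.
  have t2 := ler_wpM2r (exprn_ge0 3 (ltW L0)) t1.
  have -> : eps * ((eta * L) ^+ 4 / 24) = L * (eps * eta ^+ 4) * L ^+ 3 / 24 by ring.
  by rewrite ler_pdivlMr //; lra.
have h4 : (1 + A) * eps <= 2 * L.
  apply: (@le_trans _ _ (2 * A * eps)); last by lra.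
  by rewrite ler_wpM2r ?(ltW e0) //; lra.
apply: (@le_trans _ _ (y * expR (eta * L))); last first.
  by rewrite ler_wpM2r ?expR_ge0 //; lra.
apply: (@le_trans _ _ (y * L ^+ 2 * (1 + A))); first by rewrite ler_wpM2r // ltW.
rewrite -mulrA ler_wpM2l ?(ltW y0) // -(ler_pM2r e0) -mulrA [leRHS]mulrC.
apply: le_trans h3; apply: (@le_trans _ _ (L ^+ 2 * (2 * L))).
  by rewrite ler_wpM2l ?(ltW L2).
by rewrite [L ^+ 3]exprS; lra.
Qed.

(** The constant [eta = eps / (2 * (1 + eps))] satisfies [(1 - eta) * (1 + eps) = 1 + eps / 2]; the
    surplus [eps / 2 * n] covers the rounding loss [j]. *)
Lemma box_sum_estimate (eps n L A b u j : R) : 0 < eps -> 0 < n -> 1 <= A ->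
  10 / eps <= L -> 1 <= L -> 0 <= b -> j * L ^+ 2 <= n ->
  (1 + eps) * (A * n) <= b * (A + L) ->
  (1 - eps / (2 * (1 + eps))) * L <= u ->
  n <= b + b / A * u - j.
Proof.
move=> e0 n0 A1 Le L1 b0 jn hb hu.
have A0 : 0 < A by lra.
set eta := eps / _ in hu.
have s0 : 0 < 2 * (1 + eps) by rewrite mulr_gt0 //; lra.
have eta2 : eta * (2 * (1 + eps)) = eps by rewrite /eta divfK // gt_eqF.
have eta0 : 0 < eta by rewrite divr_gt0.
have eta_le1 : eta <= 1 by rewrite ler_pdivrMr //; lra.
clearbody eta.
have jn2 : j <= eps / 2 * n.
  have : 10 <= L * eps by rewrite -ler_pdivrMr.
  have L2 : 0 < L ^+ 2 by rewrite exprn_gt0 //; lra.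
  have : L * eps <= L ^+ 2 * eps.
    by rewrite ler_wpM2r ?(ltW e0) // expr2 ler_peMl //; lra.
  move=> h1 h2; rewrite -(ler_pM2r L2); apply: (le_trans jn).
  have -> : eps / 2 * n * L ^+ 2 = (L ^+ 2 * eps / 2) * n by ring.
  by rewrite ler_peMl ?(ltW n0) //; lra.
have ba0 : 0 <= b / A by rewrite divr_ge0 // ltW.
have hab : (1 + eps) * n <= b / A * L + b.
  have -> : b / A * L + b = b * (A + L) / A by field; rewrite gt_eqF.
  by rewrite ler_pdivlMr //; lra.
have h1 := ler_wpM2l ba0 hu.
have h2 : (1 - eta) * ((1 + eps) * n) <= (1 - eta) * (b / A * L + b).
  by rewrite ler_wpM2l // subr_ge0.
have h3 : (1 - eta) * ((1 + eps) * n) = n + eps / 2 * n.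
  have -> : (1 - eta) * ((1 + eps) * n) =
      n + eps * n - eta * (2 * (1 + eps)) * n / 2 by field.
  by rewrite eta2; field.
have h4 : 0 <= eta * b by rewrite mulr_ge0 // ltW.
rewrite h3 in h2; clear - h1 h2 h4 jn2; move: (b / A) h1 h2 => w h1 h2; lra.
Qed.

Lemma breaker_wins_asymptotically (eps : R) : 0 < eps ->
  exists n0 : nat, forall n, (n0 <= n)%N -> forall a b : nat, (0 < a)%N ->
  (1 + eps) * (a%:R * n%:R / (a%:R + ln n%:R)) <= b%:R -> wins Breaker n a b.
Proof.
move=> e0.
pose eta := eps / (2 * (1 + eps)); pose C := 1 + eps^-1.
pose L0 := 24 + 4 * C + 12 * C / eps + 10 / eps +
  48 / (eps * eta ^+ 4).
have [n1 Hn1] := ln_large L0; exists (maxn n1 1) => n.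
rewrite geq_max => /andP[nn1 n_gt0] a b a0 hb.
have {Hn1} := Hn1 n nn1; set L := ln n%:R => hL; rewrite -/L in hb.
have [nb|bn] := leqP n.-1 b; first exact: breaker_wins_first_move.
have nR : 0 < n%:R :> R by rewrite ltr0n.
have aR : 0 < a%:R :> R by rewrite ltr0n.
have a1 : 1 <= a%:R :> R by rewrite ler1n.
have bnR : b%:R < n%:R :> R by rewrite ltr_nat; lia.
have ei : 0 < eps^-1 by rewrite invr_gt0.
have eta0 : 0 < eta by rewrite divr_gt0 // mulr_gt0 //; lra.
have C0 : 0 < C by rewrite /C; lra.
have q1 : 0 <= C / eps by rewrite divr_ge0 // ltW.
have q3 : 0 <= 48 / (eps * eta ^+ 4).
  by rewrite divr_ge0 // mulr_ge0 ?exprn_ge0 // ltW.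
have [L24 LC LCe Le] : [/\ 24 <= L, 4 * C <= L, 12 * C / eps <= L & 10 / eps <= L].
  by move: hL; rewrite /L0; split; lra.
have Leta : 48 / (eps * eta ^+ 4) <= L by move: hL; rewrite /L0; lra.
have L_gt0 : 0 < L by lra.
have nL3 : L ^+ 3 <= n%:R.
  have := @quartic_le_exp R L (ltW L_gt0); rewrite lnK ?posrE // exprS.
  have : 0 < L ^+ 3 by rewrite exprn_gt0.
  move: (L ^+ 3) => y y0; apply: le_trans.
  by rewrite ler_pdivlMr // mulrC ler_wpM2r // ltW.
(* A threshold below [n] forces [(1 + eps) * a < a + L]. *)
have aeL : a%:R < L / eps.
  rewrite ltr_pdivlMr //; have aL : 0 < a%:R + L by lra.
  have := le_lt_trans hb bnR; rewrite mulrA ltr_pdivrMr // => h.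
  have : (1 + eps) * a%:R < a%:R + L by rewrite -(ltr_pM2r nR); move: h; lra.
  lra.
pose q : R := n%:R / L ^+ 2.
have L2 : 0 < L ^+ 2 by rewrite exprn_gt0.
have qL : q * L ^+ 2 = n%:R by rewrite divfK // gt_eqF.
have q0 : 0 < q by rewrite divr_gt0.
(* The clique has about [n / L ^+ 2] vertices: few enough to be built with bias [b], yet enough for
   the logarithm gained to be nearly [L]. *)
pose j := Num.truncn (q / a%:R).
have jq : j%:R * a%:R <= q.
  by rewrite -ler_pdivlMr // truncn_le divr_ge0 // ltW.
have qj : q < j.+1%:R * a%:R by rewrite -ltr_pdivrMr // truncnS_gt.
have j0 : 0 <= j%:R :> R by exact: ler0n.
have b0 : 0 <= b%:R :> R by exact: ler0n.
have LC0 : 0 < L * C by rewrite mulr_gt0.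
have aL : 0 < a%:R + L by lra.
have hb' : (1 + eps) * (a%:R * n%:R) <= b%:R * (a%:R + L).
  by rewrite -ler_pdivrMr // -mulrA.
have aLC : a%:R + L <= L * C by rewrite /C mulrDr mulr1; lra.
have hbC : a%:R * n%:R <= b%:R * (L * C).
  apply: le_trans (ler_wpM2l b0 aLC); apply: le_trans hb'.
  by rewrite ler_peMl ?mulr_ge0 //; lra.
have Lqe : L <= L ^+ 2 by rewrite expr2 ler_peMl ?ltW //; lra.
have Le2 : 10 / eps * L <= L ^+ 3.
  apply: (@le_trans _ _ (L * L)); first by rewrite ler_wpM2r // ltW.
  by rewrite -expr2 [leRHS]exprS ler_peMl ?ltW //; lra.
apply: (@breaker_wins_large_sum n a b j).
- rewrite -(ler_nat R) -(ler_pM2r LC0); apply: le_trans hbC.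
  rewrite natrM -addnA natrD natrD natrM -[a.+1%:R]natr1.
  apply: (@le_trans _ _ (2 * a%:R * (3 * a%:R + q) * (L * C))).
    rewrite ler_wpM2r ?(ltW LC0) // ler_pM //; try lra.
  have t1 : a%:R * (L * C) <= L / eps * (L * C) by rewrite ler_wpM2r ?ltW.
  have t2 : 12 * C / eps * L ^+ 2 <= L ^+ 3.
    by rewrite [leRHS]exprS ler_wpM2r ?(ltW L2).
  have t3 : q * (L * C) * 4 <= n%:R.
    by have := ler_wpM2l (ltW (mulr_gt0 q0 L_gt0)) LC; rewrite -qL expr2; lra.
  have t4 : L / eps * (L * C) * 12 = 12 * C / eps * L ^+ 2 by ring.
  have t5 : 2 * (3 * a%:R + q) * (L * C) <= n%:R by lra.
  by have := ler_wpM2l (ltW aR) t5; lra.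
- rewrite -(ler_nat R) !natrD !natrM !natrD natrM -[a.+1%:R]natr1.
  have t1 : a%:R * q <= L / eps * q by rewrite ler_wpM2r ?ltW.
  have t2 : 6 / eps * L <= L ^+ 2.
    by rewrite expr2 ler_wpM2r ?(ltW L_gt0) //; lra.
  have t3 : L / eps * q * 6 <= n%:R.
    by rewrite -qL; move: (ler_wpM2l (ltW q0) t2); lra.
  have t4 : a%:R * (1 + j%:R * a%:R) <= a%:R * (1 + q).
    by rewrite ler_wpM2l ?(ltW aR) // lerD2l.
  have t5 : q <= a%:R * q by rewrite ler_peMl // ltW.
  by lra.
rewrite -(ler_nat R); apply: le_trans (sum_div_ge b j a0).
apply: (@le_trans _ _ n%:R); first by rewrite ler_nat leq_pred.
have hln : (1 - eta) * L <= ln (1 + j.+1%:R * a%:R) - ln (1 + a%:R).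
  apply: (@ln_gap_estimate eps) => //; first by rewrite -ler_pdivlMr // ltW.
  by rewrite lnK ?posrE // -qL ler_wpM2r ?(ltW L2) ?(ltW qj).
apply: box_sum_estimate hb' hln => //; first by rewrite (le_trans _ L24) // ler1n.
rewrite -qL ler_wpM2r ?(ltW L2) //; apply: le_trans jq.
by rewrite ler_peMr.
Qed.

End BreakerAsymptotics.

(** * The two ranges of [a] and the conclusion *)

Import numFieldNormedType.Exports.

Local Open Scope classical_set_scope.
Local Open Scope ring_scope.
(** The root of [n / ln n] exceeds any fixed multiple of [ln n] once [n] exceeds a large multiple of
    [(ln n) ^ 3], and this follows from [quartic_le_exp]. *)
Lemma large_bias_dominates_ln (R : realType) (a : nat -> nat) (eps : R) : 0 < eps ->
  (fun n : nat => (a n)%:R : R^o)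
     =Omega_\oo (fun n : nat => Num.sqrt (n%:R / ln n%:R) : R^o) ->
  exists n0 : nat, forall n, (n0 <= n)%N ->
    0 < ln n%:R :> R /\ ln n%:R <= eps * (a n)%:R.
Proof.
move=> e0; rewrite eqOmegaE => /asboolP[c c0 [N _ HN]].
have ec0 : 0 < eps * c by rewrite mulr_gt0.
have [n1 Hn1] := ln_large (1 + 24 / (eps * c) ^+ 2).
exists (maxn N (maxn n1 1)) => n; rewrite !geq_max => /and3P[nN nn1 n1'].
have := HN n nN; have := Hn1 n nn1; rewrite /=.
rewrite ger0_norm ?sqrtr_ge0 // ger0_norm ?ler0n //.
have nR : 0 < n%:R :> R by rewrite ltr0n.
set L := ln n%:R => hL hc.
have q0 : 0 < 24 / (eps * c) ^+ 2 by rewrite divr_gt0 ?exprn_gt0.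
have L0 : 0 < L by lra.
split=> //; have t0 : 0 <= L / (eps * c) by rewrite divr_ge0 // ltW.
suff sq : L / (eps * c) <= Num.sqrt (n%:R / L).
  move: sq; rewrite ler_pdivrMr // => sq; apply: (le_trans sq).
  by rewrite mulrC -mulrA ler_wpM2l ?(ltW e0).
rewrite -(ger0_norm t0) -sqrtr_sqr ler_wsqrtr // expr_div_n ler_pdivlMr //.
have ec2 : 0 < (eps * c) ^+ 2 by rewrite exprn_gt0.
rewrite mulrAC ler_pdivrMr // -exprSr.
have := @quartic_le_exp R L (ltW L0); rewrite lnK ?posrE // exprS.
have : 24 <= L * (eps * c) ^+ 2 by rewrite -ler_pdivrMr //; lra.
have L3 : 0 < L ^+ 3 by rewrite exprn_gt0.
move=> /(ler_wpM2l (ltW L3)) h1; rewrite ler_pdivrMr // => h2.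
have h3 := ler_wpM2r (ltW ec2) h2.
by move: h1 h3; lra.
Qed.

Theorem theorem16 (R : realType) (a : nat -> nat) (a_gt0 : forall n, (0 < a n)%N) :
  ((fun n : nat => (a n)%:R : R^o)
     =o_\oo (fun n : nat => Num.sqrt (n%:R / ln n%:R) : R^o) ->
   forall eps : R, 0 < eps ->
   exists n0 : nat, forall n : nat, (n0 <= n)%N ->
   forall b : nat, (0 < b)%N ->
     ((1 + eps) * ((a n)%:R * n%:R / ((a n)%:R + ln n%:R)) <= b%:R ->
        wins Breaker n (a n) b) /\
     (b%:R <= (1 - eps) * ((a n)%:R * n%:R / ((a n)%:R + ln n%:R)) ->
        wins Maker n (a n) b))
  /\
  ((fun n : nat => (a n)%:R : R^o)
     =Omega_\oo (fun n : nat => Num.sqrt (n%:R / ln n%:R) : R^o) ->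
   forall eps : R, 0 < eps ->
   exists n0 : nat, forall n : nat, (n0 <= n)%N ->
   forall b : nat, (0 < b)%N ->
     ((1 + eps) * n%:R <= b%:R -> wins Breaker n (a n) b) /\
     (b%:R <= (1 - eps) * n%:R -> wins Maker n (a n) b)).
Proof.
split=> [_|a_large] eps e0.
  have [nB HB] := breaker_wins_asymptotically e0.
  have [nM HM] := maker_wins_asymptotically e0.
  exists (maxn nB nM) => n; rewrite geq_max => /andP[nnB nnM] b b0.
  by split; [exact: HB | exact: HM].
have e2 : 0 < eps / 2 by rewrite divr_gt0.
(* Half of [eps] pays for replacing [a n / (a + ln n)] by [n], because [ln n <= eps / 2 * a]. *)
have [nM HM] := maker_wins_asymptotically e2.
have [nL HL] := large_bias_dominates_ln e2 a_large.
exists (maxn 1 (maxn nM nL)) => n; rewrite !geq_max => /and3P[n1 nnM nnL] b b0.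
have nR : 0 < n%:R :> R by rewrite ltr0n.
split=> hb.
  apply: breaker_wins_first_move => //; apply: leq_trans (leq_pred n) _.
  by rewrite -(ler_nat R); apply: le_trans hb; rewrite ler_peMl ?ltW // ltrDl.
have bR : 0 < b%:R :> R by rewrite ltr0n.
have [L0 La] := HL n nnL.
have aR : 0 < (a n)%:R :> R by rewrite ltr0n.
have e1 : eps < 1.
  by rewrite -subr_gt0 -(pmulr_lgt0 _ nR); exact: lt_le_trans bR hb.
apply: HM => //; apply: (le_trans hb).
have aL : 0 < (a n)%:R + ln n%:R :> R by rewrite addr_gt0.
rewrite [(a n)%:R * _]mulrC -!mulrA mulrCA [leLHS]mulrC ler_wpM2l ?(ltW nR) //.
rewrite mulrA ler_pdivlMr //.
have : eps * ln n%:R >= 0 by rewrite mulr_ge0 ?ltW.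
by move: La; lra.
Qed.
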